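(* The uniform semi-spread of Thompson's group $F$ is equal to $1$.
   Context: Thompson's group $F$ is the group (under composition) of all orientation-preserving piecewise-linear homeomorphisms of $[0,1]$ with finitely many breakpoints, all breakpoints being dyadic fractions (elements of $\mathbb{Z}[\frac12]\cap(0,1)$) and all slopes being integer powers of $2$. It is $2$-generated, and its abelianization is $\mathbb{Z}^2$, the abelianization map being $\pi\colon F\to\mathbb{Z}^2$, $\pi(f)=(\log_2 f'(0^+),\log_2 f'(1^-))$. In a group $G$, an element $y$ is a co-generator of $x$ if $\langle x,y\rangle=G$; $y$ is a common co-generator of $x_1,\dots,x_k$ if $\langle x_i,y\rangle=G$ for every $i$. For a $2$-generated group $G$ with abelianization $A=G/[G,G]$ and abelianization map $\pi_G\colon G\to A$, the uniform semi-spread of $G$ is the supremum over all integers $k$ such that the following holds: for every $a\in A$ that is part of a generating pair of $A$ there exists $g\in G$ such that (i) $\pi_G(g)=a$; and (ii) every $k$ elements $x_1,\dots,x_k\in G$ such that $\pi_G(g)$ is a common co-generator of $\pi_G(x_1),\dots,\pi_G(x_k)$ in $A$ have a common co-generator in $G$ that is a conjugate of $g$. *)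

(* Defs.v *)
From HB Require Import structures.
From mathcomp Require Import all_boot all_order all_algebra.
From mathcomp Require Import all_classical all_reals all_analysis.
From mathcomp Require Import ring lra.

Set Implicit Arguments.
Unset Strict Implicit.
Unset Printing Implicit Defensive.

Import Order.TTheory GRing.Theory Num.Theory.
Import numFieldNormedType.Exports.

Local Open Scope classical_set_scope.
Local Open Scope quotient_scope.

Section Generation.
Local Open Scope group_scope.
Variable G : groupType.
Implicit Types (x y : G) (X H : set G).

Definition is_subgroup H :=
  [/\ H 1, forall x y, H x -> H y -> H (x * y) & forall x, H x -> H x^-1].

Definition generated X : set G := smallest is_subgroup X.

Definition cogenerator x y := generated [set x; y] = setT.

Definition derived_subgroup : set G :=
  generated [set z | exists x y, z = [~ x, y]].

Lemma generated_subgroup X : is_subgroup (generated X).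
Proof.
split=> [H [[]]//|x y Hx Hy H HX|x Hx H HX]; have [[_ HM HV] _] := HX.
  by apply: HM; [exact: Hx|exact: Hy].
by apply: HV; exact: Hx.
Qed.

Lemma derived_commg x y : derived_subgroup [~ x, y].
Proof. by apply: sub_gen_smallest; exists x, y. Qed.

Lemma derivedJ x y : derived_subgroup x -> derived_subgroup (x ^ y).
Proof.
have [_ DM _] := generated_subgroup [set z | exists x y, z = [~ x, y]].
by move=> Dx; rewrite -[x ^ y](mulVKg x); apply: DM => //; exact: derived_commg.
Qed.

Definition derived_equiv : rel G := fun x y => `[< derived_subgroup (x^-1 * y) >].

Lemma derived_equivE : equiv_class_of derived_equiv.
Proof.
have [D1 DM DV] := generated_subgroup [set z | exists x y, z = [~ x, y]].
split=> [x|x y|y x z] /=.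
- by apply/asboolP; rewrite mulVg.
- by apply/asboolP/asboolP => /DV; rewrite invgM invgK.
- move=> /asboolP Dxy /asboolP Dyz; apply/asboolP.
  by rewrite -[z](mulVKg y) mulgA; exact: DM.
Qed.

Canonical derived_equiv_rel := EquivRelPack derived_equivE.

Definition abelianization := {eq_quot derived_equiv}.

HB.instance Definition _ := Choice.on abelianization.
HB.instance Definition _ := EqQuotient.on abelianization.

Definition to_abelianization x : abelianization := \pi_abelianization x.

Lemma to_abelianizationP x y :
  to_abelianization x = to_abelianization y <-> derived_subgroup (x^-1 * y).
Proof.
split=> [/eqquotP/asboolP//|Dxy]; apply/eqquotP; exact/asboolP.
Qed.

Lemma to_abelianizationK (a : abelianization) : to_abelianization (repr a) = a.
Proof. exact: reprK. Qed.

Definition ab_one : abelianization := to_abelianization 1.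
Definition ab_mul (a b : abelianization) : abelianization :=
  to_abelianization (repr a * repr b).
Definition ab_inv (a : abelianization) : abelianization :=
  to_abelianization (repr a)^-1.

Lemma to_abM x y : to_abelianization (x * y) =
  ab_mul (to_abelianization x) (to_abelianization y).
Proof.
have [_ DM _] := generated_subgroup [set z | exists x y, z = [~ x, y]].
apply/to_abelianizationP.
set x' := repr _; set y' := repr _.
have Dx : derived_subgroup (x^-1 * x').
  by apply/to_abelianizationP; rewrite to_abelianizationK.
have Dy : derived_subgroup (y^-1 * y').
  by apply/to_abelianizationP; rewrite to_abelianizationK.
have -> : (x * y)^-1 * (x' * y') = (x^-1 * x') ^ y * (y^-1 * y').
  rewrite conjgE (@invgM G) -(@mulgA G _ _ (y^-1 * y')) -(@mulgA G _ y).
  by rewrite (@mulVKg G) !mulgA.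
by apply: DM => //; exact: derivedJ.
Qed.

Lemma to_abV x : to_abelianization x^-1 = ab_inv (to_abelianization x).
Proof.
have [_ _ DV] := generated_subgroup [set z | exists x y, z = [~ x, y]].
apply/to_abelianizationP; set x' := repr _.
have Dx : derived_subgroup (x^-1 * x').
  by apply/to_abelianizationP; rewrite to_abelianizationK.
have -> : x^-1^-1 * x'^-1 = (x^-1 * x')^-1 ^ x^-1.
  by rewrite conjgE (@invgM G) -(@mulgA G x'^-1) !(@invgK G) (@mulgV G) (@mulg1 G).
by apply: derivedJ; exact: DV.
Qed.

Lemma ab_mulA : associative ab_mul.
Proof.
move=> a b c; rewrite -(to_abelianizationK a) -(to_abelianizationK b).
by rewrite -(to_abelianizationK c) -!to_abM mulgA.
Qed.

Lemma ab_mul1 : left_id ab_one ab_mul.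
Proof. by move=> a; rewrite -(to_abelianizationK a) -to_abM mul1g. Qed.

Lemma ab_1mul : right_id ab_one ab_mul.
Proof. by move=> a; rewrite -(to_abelianizationK a) -to_abM mulg1. Qed.

Lemma ab_mulV : left_inverse ab_one ab_inv ab_mul.
Proof.
by move=> a; rewrite -(to_abelianizationK a) -to_abV -to_abM mulVg.
Qed.

Lemma ab_Vmul : right_inverse ab_one ab_inv ab_mul.
Proof.
by move=> a; rewrite -(to_abelianizationK a) -to_abV -to_abM mulgV.
Qed.

HB.instance Definition _ :=
  isGroup.Build abelianization ab_mulA ab_mul1 ab_1mul ab_mulV ab_Vmul.

Lemma to_abF : {morph to_abelianization : x y / x / y}.
Proof. by move=> x y; rewrite to_abM to_abV. Qed.

HB.instance Definition _ :=
  isGroupMorphism.Build G abelianization to_abelianization to_abF.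

End Generation.

Section UniformSemiSpread.
Local Open Scope group_scope.

(* [g ^ h] is the conjugate [h^-1 * g * h]. *)
Definition uniform_semi_spread_ge (G : groupType) (k : nat) : Prop :=
  forall a : abelianization G, (exists b, cogenerator a b) ->
  exists g : G, to_abelianization g = a /\
    forall x : 'I_k -> G,
      (forall i, cogenerator (to_abelianization (x i)) (to_abelianization g)) ->
      exists h : G, forall i, cogenerator (x i) (g ^ h).

(* The supremum is taken in the extended reals, so that it may be infinite. *)
Definition uniform_semi_spread (R : realType) (G : groupType) : \bar R :=
  ereal_sup [set (k%:R)%R%:E | k in uniform_semi_spread_ge G].

End UniformSemiSpread.

Notation unit_interval R := (set_type (`[0%R, 1%R]%classic : set R)).

Section Thompson.
Local Open Scope ring_scope.
Variable R : realType.
Local Notation I := (unit_interval R).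
Implicit Types (f g : I -> I) (x y a b : I).

Definition dyadic (r : R) : Prop := exists (m : int) (k : nat), r = m%:~R / 2 ^+ k.

(* Continuity is for the subspace topology that [set_type] inherits from [R]. *)
Definition homeomorphism f : Prop :=
  exists g, [/\ cancel f g, cancel g f, continuous f & continuous g].

Definition orientation_preserving f : Prop :=
  {homo f : x y / \val x < \val y}.

(* Every breakpoint of [f] belongs to [s]: on each interval [[a, b]] whose
   interior avoids [s], the map is affine with slope a power of two. *)
Definition dyadic_piecewise_linear f : Prop :=
  exists2 s : seq R, (forall d, d \in s -> dyadic d /\ 0 < d < 1) &
  forall a b, (forall d, d \in s -> ~~ (\val a < d < \val b)) ->
  exists n : int, forall x, \val a <= \val x <= \val b ->
    \val (f x) = \val (f a) + 2 ^ n * (\val x - \val a).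

Definition is_thompson f : Prop :=
  [/\ homeomorphism f, orientation_preserving f & dyadic_piecewise_linear f].

Record thompsonF : Type := ThompsonF {
  thompson_fun :> I -> I;
  _ : `[< is_thompson thompson_fun >] }.

HB.instance Definition _ := [isSub for thompson_fun].
HB.instance Definition _ := [Choice of thompsonF by <:].

Lemma thompsonP (f : thompsonF) : is_thompson f.
Proof. by case: f => f /= /asboolP. Qed.

Lemma thompson_ext (f g : thompsonF) : f =1 g -> f = g.
Proof. by move=> fg; apply: val_inj; exact/funext. Qed.

Lemma dyadicD r s : dyadic r -> dyadic s -> dyadic (r + s).
Proof.
move=> [m [k ->]] [n [l ->]]; exists (m * 2 ^+ l + n * 2 ^+ k), (k + l)%N.
have k0 : (2 ^+ k : R) != 0 by rewrite expf_neq0.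
have l0 : (2 ^+ l : R) != 0 by rewrite expf_neq0.
rewrite rmorphD !rmorphM/= !rmorphXn/= exprD; field; exact/andP.
Qed.

Lemma dyadicN r : dyadic r -> dyadic (- r).
Proof. by move=> [m [k ->]]; exists (- m), k; rewrite rmorphN mulNr. Qed.

Lemma dyadicZ (n : int) r : dyadic r -> dyadic (2 ^ n * r).
Proof.
move=> [m [k ->]]; case: n => n.
  by exists (2 ^+ n * m), k; rewrite rmorphM rmorphXn /= mulrA.
exists m, (n.+1 + k)%N.
have -> : (2 : R) ^ Negz n = (2 ^+ n.+1)^-1 by [].
by rewrite exprD invfM mulrCA.
Qed.

Lemma I_range x : 0 <= \val x <= 1.
Proof. by have := valP x; rewrite inE /= in_itv. Qed.

Lemma I_in (r : R) : 0 <= r <= 1 -> r \in (`[0, 1]%classic : set R).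
Proof. by move=> r01; rewrite inE /= in_itv. Qed.

Lemma I0_subproof : 0 \in (`[0, 1]%classic : set R).
Proof. by apply: I_in; rewrite lexx ler01. Qed.

Lemma I1_subproof : 1 \in (`[0, 1]%classic : set R).
Proof. by apply: I_in; rewrite lexx ler01. Qed.

Let I0 : I := exist _ 0 I0_subproof.
Let I1 : I := exist _ 1 I1_subproof.
Let toI (r : R) : I := insubd I0 r.

Lemma toIK (r : R) : 0 < r < 1 -> \val (toI r) = r.
Proof.
by move=> /andP[r0 r1]; rewrite insubdK//; apply: I_in; rewrite !ltW.
Qed.

Lemma thompson_lt f : orientation_preserving f ->
  forall x y, (\val (f x) < \val (f y)) = (\val x < \val y).
Proof.
move=> fo x y; apply/idP/idP; last exact: fo.
case: (ltgtP (\val x) (\val y)) => // [/fo yx xy|/val_inj ->].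
  by have := lt_trans xy yx; rewrite ltxx.
by rewrite ltxx.
Qed.

Lemma thompson_le f : orientation_preserving f ->
  forall x y, (\val (f x) <= \val (f y)) = (\val x <= \val y).
Proof. by move=> fo x y; rewrite !leNgt thompson_lt. Qed.

Lemma thompson_fix f g : orientation_preserving f -> cancel g f ->
  f I0 = I0 /\ f I1 = I1.
Proof.
move=> fo gK; split; apply: val_inj; apply/eqP; rewrite eq_le; apply/andP; split.
- rewrite -{2}(gK I0) thompson_le//; by have /andP[] := I_range (g I0).
- by have /andP[] := I_range (f I0).
- by have /andP[] := I_range (f I1).
- rewrite -{1}(gK I1) thompson_le//; by have /andP[] := I_range (g I1).
Qed.

Lemma thompson_open f g : orientation_preserving f -> cancel g f ->
  forall x, (0 < \val (f x) < 1) = (0 < \val x < 1).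
Proof.
move=> fo gK x; have [f0 f1] := thompson_fix fo gK.
have := thompson_lt fo I0 x; have := thompson_lt fo x I1.
by rewrite f0 f1 => -> ->.
Qed.

Lemma count_lt (T : eqType) (P Q : pred T) (s : seq T) d :
  subpred P Q -> d \in s -> Q d -> ~~ P d -> (count P s < count Q s)%N.
Proof.
move=> PQ + Qd Pd; elim: s => //= x s IH; rewrite inE => /predU1P[<-|/IH h].
  by rewrite Qd (negbTE Pd) add0n add1n ltnS sub_count.
rewrite -addnS leq_add//.
by case Px: (P x) => //; rewrite PQ.
Qed.

Lemma thompson_dyadic f g : orientation_preserving f -> cancel g f ->
  dyadic_piecewise_linear f -> forall x, dyadic (\val x) <-> dyadic (\val (f x)).
Proof.
move=> fo gK [s s01 fs] x; have [f0 _] := thompson_fix fo gK.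
have dy0 : dyadic 0 by exists 0, 0%N; rewrite mul0r.
suff H n a b : (count (fun d => (\val a < d < \val b)%R) s <= n)%N ->
    \val a <= \val b -> dyadic (\val a) -> dyadic (\val (f a)) ->
    (dyadic (\val b) <-> dyadic (\val (f b))).
  apply: (H _ I0 x (leqnn _)) => //; last by rewrite f0.
  by have /andP[] := I_range x.
elim: n a b => [|n IH] a b.
  rewrite leqn0 => /eqP s0 ab da dfa.
  have [d ds|m fm] := fs a b.
    apply/negP => dab; suff : (0 < count (fun d => (\val a < d < \val b)%R) s)%N.
      by rewrite s0.
    by rewrite -has_count; apply/hasP; exists d.
  have -> : \val (f b) = \val (f a) + 2 ^ m * (\val b - \val a).
    by apply: fm; rewrite lexx ab.
  split=> h; first by apply: dyadicD => //; apply/dyadicZ/dyadicD/dyadicN.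
  have -> : \val b = \val a + 2 ^ (- m) *
      ((\val (f a) + 2 ^ m * (\val b - \val a)) - \val (f a)).
    have m0 : (2 ^ m : R) != 0 by rewrite expfz_neq0.
    by rewrite -invr_expz; field.
  by apply: dyadicD => //; apply/dyadicZ/dyadicD/dyadicN.
move=> sn ab da dfa.
have [/hasP[d ds /andP[ad db]]|] := boolP (has (fun d => \val a < d < \val b) s);
    last first.
  by move=> /[dup] h; rewrite has_count -leqNgt leqn0 => /eqP c0; apply: (IH a b) => //; rewrite c0.
have [dd d01] := s01 d ds.
pose y := toI d.
have yd : \val y = d by exact: toIK.
have dfy : dyadic (\val (f y)).
  apply/(IH a y) => //; rewrite yd ?(ltW ad)//.
  rewrite -ltnS; apply: leq_trans sn; apply: (count_lt _ ds).
  - by move=> z /andP[-> /lt_trans->].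
  - by rewrite ad db.
  - by rewrite ltxx andbF.
apply: (IH y b) => //; rewrite yd ?(ltW db)//.
rewrite -ltnS; apply: leq_trans sn; apply: (count_lt _ ds).
- by move=> z /andP[/(lt_trans ad)-> ->].
- by rewrite ad db.
- by rewrite ltxx.
Qed.

Lemma thompson_comp f g : is_thompson f -> is_thompson g -> is_thompson (f \o g).
Proof.
move=> [[f' [fK f'K fc f'c]] fo fpl] [[g' [gK g'K gc g'c]] go gpl]; split.
- exists (g' \o f'); split; [exact: can_comp|exact: can_comp| |].
  + by move=> x; apply: continuous_comp; [exact: gc|exact: fc].
  + by move=> x; apply: continuous_comp; [exact: f'c|exact: g'c].
- by move=> x y xy; apply/fo/go.
have gd := thompson_dyadic go g'K gpl.
have gI := thompson_open go g'K.
have gE d : 0 < d < 1 -> \val (g (g' (toI d))) = d.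
  by move=> d01; rewrite g'K toIK.
case: fpl gpl => [s s01 fs] [t t01 gt].
exists (t ++ [seq \val (g' (toI d)) | d <- s]) => [d|a b h].
  rewrite mem_cat => /orP[/t01//|/mapP[{}d /s01[dd d01] ->]].
  by rewrite -gI; split; [apply/gd|]; rewrite gE.
have [d dt|n gn] := gt a b; first by apply: h; rewrite mem_cat dt.
have [d ds|m fm] := fs (g a) (g b).
  have [_ d01] := s01 d ds.
  rewrite -(gE d d01) !thompson_lt//; apply: h.
  by rewrite mem_cat; apply/orP; right; apply/mapP; exists d.
exists (m + n) => x xab; have gx := gn x xab.
rewrite /= fm ?thompson_le// gx expfzDr// (addrAC (\val (g a))) subrr.
by rewrite add0r mulrA.
Qed.

Lemma thompson_can f g : is_thompson f -> cancel f g -> cancel g f ->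
  is_thompson g.
Proof.
move=> [[f' [fK f'K fc f'c]] fo fpl] fg gf.
have f'g : f' = g by apply/funext => x; rewrite -{1}(gf x) fK.
subst f'; split.
- by exists f.
- by move=> x y; rewrite -{1}(gf x) -{1}(gf y) thompson_lt.
have fd := thompson_dyadic fo gf fpl.
have fI := thompson_open fo gf.
case: fpl => [s s01 fs].
exists [seq \val (f (toI d)) | d <- s] => [d|a b h].
  move=> /mapP[{}d /s01[dd d01] ->].
  by rewrite fI; split; [apply: (fd _).1|]; rewrite toIK.
have [d ds|n fn] := fs (g a) (g b).
  have [_ d01] := s01 d ds.
  rewrite -(toIK d01) -(thompson_lt fo (g a)) -(thompson_lt fo _ (g b)) !gf; apply: h.
  by apply/mapP; exists d.
exists (- n) => x xab.
have := fn (g x); rewrite -(thompson_le fo (g a)) -(thompson_le fo _ (g b)) !gf => /(_ xab) xE.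
have n0 : (2 ^ n : R) != 0 by rewrite expfz_neq0.
by rewrite -invr_expz xE; field.
Qed.

Lemma thompson_id : is_thompson id.
Proof.
split=> //; first by exists id; split=> // x; exact: cvg_id.
by exists [::] => // a b _; exists 0 => x _; rewrite /= expr0z mul1r addrC subrK.
Qed.

Definition thompson_one : thompsonF := ThompsonF (introT (asboolP _) thompson_id).

(* [f * g] applies [g] first. *)
Definition thompson_mul (f g : thompsonF) : thompsonF :=
  ThompsonF (introT (asboolP _) (thompson_comp (thompsonP f) (thompsonP g))).

Lemma thompson_inv_subproof (f : thompsonF) :
  {g : thompsonF | cancel f g /\ cancel g f}.
Proof.
apply: cid; have [[g [fK gK _ _]] _ _] := thompsonP f.
by exists (ThompsonF (introT (asboolP _) (thompson_can (thompsonP f) fK gK))).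
Qed.

Definition thompson_inv (f : thompsonF) : thompsonF :=
  sval (thompson_inv_subproof f).

Lemma thompson_invK (f : thompsonF) :
  cancel f (thompson_inv f) /\ cancel (thompson_inv f) f.
Proof. exact: svalP (thompson_inv_subproof f). Qed.

Lemma thompson_mulA : associative thompson_mul.
Proof. by move=> f g h; exact: thompson_ext. Qed.

Lemma thompson_mul1 : left_id thompson_one thompson_mul.
Proof. by move=> f; exact: thompson_ext. Qed.

Lemma thompson_1mul : right_id thompson_one thompson_mul.
Proof. by move=> f; exact: thompson_ext. Qed.

Lemma thompson_mulV : left_inverse thompson_one thompson_inv thompson_mul.
Proof.
by move=> f; apply: thompson_ext => x /=; have [-> _] := thompson_invK f.
Qed.

Lemma thompson_Vmul : right_inverse thompson_one thompson_inv thompson_mul.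
Proof.
by move=> f; apply: thompson_ext => x /=; have [_ ->] := thompson_invK f.
Qed.

HB.instance Definition _ := isGroup.Build thompsonF
  thompson_mulA thompson_mul1 thompson_1mul thompson_mulV thompson_Vmul.

End Thompson.

(* Main.v *)
Require Import Defs.
From mathcomp Require Import all_boot all_order all_algebra.
From mathcomp Require Import all_classical all_reals all_analysis.
From mathcomp Require Import ring lra.

(* The uniform semi-spread is at most 1: if [g] has slope 2 at both ends of
   [[0, 1]], then so does every conjugate of [g], which therefore has a fixed
   point [t] in [(0, 1)].  Take [x_1] supported in [[0, 1/2]] and [x_2] supported
   in [[1/2, 1]], both with an image that generates the abelianization together
   with that of [g]; one of them fixes [t] as well.

   It is at least 1: given slopes [2^p] and [2^q] at the ends, let [g] have that
   behaviour near the ends, without fixed points there when the slope is not 1,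
   and in the middle be made of four consecutive pieces: the identity, copies of
   the two standard generators of F, and the identity again.  Given [x], choose
   [c] with [x c > c] and conjugate [g] so that its pieces live on the intervals
   [J_i = [x^i c, x^(i+1) c]] and are transported to [J_0] by [x].  Then the
   conjugates [s_i = x^-i g x^i] fix the ends of [J_0]; [s_1] and [s_2] generate F
   on it, while [s_0] and [s_3] are trivial on it and displace everything to the
   left and to the right of it, respectively.  Commutators of elements of
   [<s_1, s_2>] are trivial near 0, near 1 and near the ends of [J_0], so after
   displacing supports iterated commutators are supported in [J_0].  The compactly
   supported elements form a perfect group, so [<x, g>] contains a copy of it on
   [J_0], hence all of it, because [x] and [g] can squeeze any compact subset of
   [(0, 1)] into [J_0]. *)

Set Implicit Arguments.
Unset Strict Implicit.
Unset Printing Implicit Defensive.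

Import Order.TTheory GRing.Theory Num.Theory.
Import numFieldNormedType.Exports.
Local Open Scope classical_set_scope.
Local Open Scope ring_scope.

(** * Action on the real line *)

Section RealLine.
Variable R : realType.
Local Notation F := (thompsonF R).
Local Notation I := (unit_interval R).
Implicit Types (f g h k : F) (x y t c : R).

Let i0 : I := exist _ 0 (I0_subproof R).

(* Extending by the identity outside [0, 1] makes F act on the whole line. *)
Definition ev f x : R := if 0 <= x <= 1 then \val (f (insubd i0 x)) else x.

Lemma val_insubd_unit x : 0 <= x <= 1 -> \val (insubd i0 x) = x.
Proof. by move=> x01; rewrite insubdK//; exact: I_in. Qed.

Lemma ev_val f (a : I) : ev f (\val a) = \val (f a).
Proof.
rewrite /ev I_range; congr (\val (f _)).
by apply: val_inj; rewrite val_insubd_unit// I_range.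
Qed.

Lemma ev_out f x : ~~ (0 <= x <= 1) -> ev f x = x.
Proof. by rewrite /ev => /negbTE->. Qed.

Lemma ev_range f x : 0 <= x <= 1 -> 0 <= ev f x <= 1.
Proof. by move=> x01; rewrite /ev x01 I_range. Qed.

Lemma evM f g x : ev (f * g)%g x = ev f (ev g x).
Proof.
have [x01|x01] := boolP (0 <= x <= 1); last by rewrite !ev_out.
by rewrite -(val_insubd_unit x01) !ev_val.
Qed.

Lemma ev1 x : ev 1%g x = x.
Proof.
have [x01|x01] := boolP (0 <= x <= 1); last by rewrite !ev_out.
by rewrite -(val_insubd_unit x01) ev_val.
Qed.

Lemma evK f : cancel (ev f) (ev f^-1%g).
Proof. by move=> x; rewrite -evM mulVg ev1. Qed.

Lemma evVK f : cancel (ev f^-1%g) (ev f).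
Proof. by move=> x; rewrite -evM mulgV ev1. Qed.

Lemma ev_inj f : injective (ev f). Proof. exact: can_inj (evK f). Qed.

Lemma ev_ext f g : ev f =1 ev g -> f = g.
Proof.
by move=> fg; apply: thompson_ext => a; apply: val_inj; rewrite -!ev_val.
Qed.

Lemma ev_fix f x : ev f x = x -> ev f^-1%g x = x.
Proof. by move=> fx; rewrite -{1}fx evK. Qed.

Lemma ev_out0 f x : x <= 0 -> ev f x = x.
Proof.
rewrite le_eqVlt => /predU1P[->|x0]; last first.
  by rewrite ev_out// negb_and -ltNge x0.
have [[f' [fK f'K _ _]] fo _] := thompsonP f.
by have [f0 _] := thompson_fix fo f'K; rewrite -[in LHS](_ : \val i0 = 0)// ev_val f0.
Qed.

Lemma ev_out1 f x : 1 <= x -> ev f x = x.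
Proof.
rewrite le_eqVlt => /predU1P[<-|x1]; last first.
  by rewrite ev_out// negb_and -!ltNge x1 orbT.
have [[f' [fK f'K _ _]] fo _] := thompsonP f.
have [_ f1] := thompson_fix fo f'K.
by rewrite -[in LHS](_ : \val (exist _ 1 (I1_subproof R) : I) = 1)// ev_val f1.
Qed.

Lemma ev_lt f x y : (ev f x < ev f y) = (x < y).
Proof.
suff H g u v : u < v -> ev g u < ev g v.
  apply/idP/idP => [/(H f^-1%g)|]; last exact: H.
  by rewrite !evK.
move=> uv; have [u0|u0] := leP u 0.
  rewrite (ev_out0 _ u0); have [v0|v0] := leP v 0; first by rewrite ev_out0.
  have [v1|v1] := leP 1 v; first by rewrite ev_out1.
  rewrite (le_lt_trans u0)// -(ev_out0 g (lexx 0)).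
  have v01 : 0 <= v <= 1 by rewrite !ltW.
  have [_ go _] := thompsonP g.
  rewrite -(val_insubd_unit v01) -[in ltLHS](_ : \val i0 = 0)// !ev_val.
  by apply: go; rewrite val_insubd_unit.
have [u1|u1] := leP 1 u.
  by rewrite !ev_out1//; apply: le_trans u1 _; exact: ltW.
have u01 : 0 <= u <= 1 by rewrite !ltW.
have [v1|v1] := ltP 1 v.
  rewrite (@ev_out1 _ v (ltW v1)); apply: le_lt_trans v1.
  by have /andP[] := ev_range g u01.
have v01 : 0 <= v <= 1 by rewrite v1 andbT ltW// (lt_trans u0).
have [_ go _] := thompsonP g.
rewrite -(val_insubd_unit v01) -(val_insubd_unit u01) !ev_val.
by apply: go; rewrite !val_insubd_unit.
Qed.

Lemma ev_le f x y : (ev f x <= ev f y) = (x <= y).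
Proof. by rewrite !leNgt ev_lt. Qed.

(** Piecewise linearity on the whole line, with all breakpoints in [s]; a breakpoint may sit at an
    end of the interval. *)
Definition affine_off (s : seq R) (u : R -> R) :=
  forall a b, a <= b -> (forall d, d \in s -> d <= a \/ b <= d) ->
  exists n : int, forall x, a <= x <= b -> u x = u a + 2 ^ n * (x - a).

(** The points 0 and 1 join the list because the extension by the identity can break there. *)
Lemma ev_affine f : exists2 s : seq R, (forall d, d \in s -> dyadic d) &
  affine_off s (ev f).
Proof.
have [_ _ [s s01 sP]] := thompsonP f.
exists [:: 0, 1 & s] => [d|a b ab H].
  rewrite !inE => /orP[/eqP->|/orP[/eqP->|/s01[]//]].
    by exists 0, 0%N; rewrite mul0r.
  by exists 1, 0%N; rewrite divr1.
have id_case : (forall x, a <= x <= b -> ev f x = x) ->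
    exists n : int, forall x, a <= x <= b -> ev f x = ev f a + 2 ^ n * (x - a).
  move=> fid; exists 0 => x xab; rewrite expr0z mul1r !fid ?lexx ?ab//.
  by rewrite addrC subrK.
have [|a0|b0] := H 0; first by rewrite inE eqxx.
  have [|a1|b1] := H 1; first by rewrite !inE eqxx orbT.
    by apply: id_case => x /andP[ax _]; rewrite ev_out1// (le_trans a1).
  have a01 : 0 <= a <= 1 by rewrite a0 (le_trans ab).
  have b01 : 0 <= b <= 1 by rewrite b1 (le_trans a0).
  have [|n nP] := sP (insubd i0 a) (insubd i0 b).
    move=> d ds; rewrite !val_insubd_unit// negb_and -!leNgt.
    by apply/orP; apply: H; rewrite !inE ds !orbT.
  exists n => x /andP[ax xb].
  have x01 : 0 <= x <= 1 by rewrite (le_trans a0)// (le_trans xb).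
  rewrite -(val_insubd_unit a01) -(val_insubd_unit x01) !ev_val.
  by apply: nP; rewrite !val_insubd_unit// ax.
by apply: id_case => x /andP[_ xb]; rewrite ev_out0// (le_trans xb).
Qed.

(** The preimage under [u] of the interval of radius [e] about [u x] lies between [v (u x - e)] and
    [v (u x + e)], and is a neighbourhood of [x]. *)
Lemma mono_continuous (u v : R -> R) : {homo u : x y / x < y} -> cancel u v ->
  cancel v u -> continuous u.
Proof.
move=> um uK vK x; apply/cvgrPdist_lt => e e0.
have ule y z : u y < u z -> y < z.
  by move=> uyz; case: (ltgtP y z) uyz => // [/um /lt_trans h /h|->]; rewrite ltxx.
have xl : v (u x - e) < x by apply: ule; rewrite vK ltrBlDr ltrDl.
have xr : x < v (u x + e) by apply: ule; rewrite vK ltrDl.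
near=> y.
have /um : v (u x - e) < y by near: y; exact: lt_nbhsr.
have /um : y < v (u x + e) by near: y; exact: lt_nbhsl.
by rewrite !vK ltr_distlC => -> ->.
Unshelve. all: by end_near. Qed.

(** This is how elements are built from formulas. Continuity comes for free from monotonicity, so it
    suffices to give an explicit inverse, dyadic breakpoints and the identity off the unit
    interval. *)
Lemma is_thompson_real (u v : R -> R) (s : seq R) :
  {homo u : x y / x < y} -> cancel u v -> cancel v u ->
  (forall x, x <= 0 \/ 1 <= x -> u x = x) ->
  (forall d, d \in s -> dyadic d) -> affine_off s u ->
  exists f, ev f =1 u.
Proof.
move=> um uK vK uid sd saff.
have vid x : x <= 0 \/ 1 <= x -> v x = x by move=> /uid {1}<-; rewrite uK.
have ule y z : u y < u z -> y < z.
  by move=> uyz; case: (ltgtP y z) uyz => // [/um /lt_trans h /h|->]; rewrite ltxx.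
have vm : {homo v : x y / x < y} by move=> x y xy; apply: ule; rewrite !vK.
have rng (w : R -> R) : {homo w : x y / x < y} ->
    (forall x, x <= 0 \/ 1 <= x -> w x = x) ->
    forall a : I, w (\val a) \in (`[0, 1]%classic : set R).
  move=> wm wid a; apply: I_in; have /andP[] := I_range a.
  have wle : {homo w : x y / x <= y} by exact: ltW_homo.
  move=> /wle + /wle; rewrite (wid 0) ?(wid 1) => [->->//| |]; [right|left]; exact: lexx.
pose lift (w : R -> R) wm wid (a : I) : I :=
  exist (fun r : R => r \in (`[0, 1]%classic : set R)) (w (\val a)) (rng w wm wid a).
pose fu := lift u um uid; pose fv := lift v vm vid.
have cont w wm wid : continuous w -> continuous (lift w wm wid).
  move=> wc; apply: continuous_comp_initial => x /=.
  have := @continuous_comp _ _ _ (\val : I -> R) w x.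
  by apply; [exact: initial_continuous|exact: wc].
have fP : `[< is_thompson fu >].
  apply/asboolP; split.
  - exists fv; split.
    + by move=> a; apply: val_inj; rewrite /= uK.
    + by move=> a; apply: val_inj; rewrite /= vK.
    + by apply: cont; exact: (mono_continuous um uK vK).
    + by apply: cont; exact: (mono_continuous vm vK uK).
  - by move=> a b /um.
  - exists [seq d <- s | 0 < d < 1] => [d|a b H].
      by rewrite mem_filter => /andP[d01 /sd dd].
    have [ab|ba] := leP (\val a) (\val b); last first.
      (* If [b < a], no [x] lies between the two, so any exponent serves. *)
      exists 0 => x /andP[ax xb].
      by have := lt_le_trans ba (le_trans ax xb); rewrite ltxx.
    have [d ds|n nP] := saff (\val a) (\val b) ab; last by exists n => x /nP.
    apply/orP; rewrite !leNgt -negb_and.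
    have [d01|] := boolP (0 < d < 1); first by apply: H; rewrite mem_filter d01.
    apply: contra => /andP[ad db].
    have /andP[a0 _] := I_range a; have /andP[_ b1] := I_range b.
    by rewrite (le_lt_trans a0 ad) (lt_le_trans db b1).
exists (ThompsonF fP) => x.
have [x01|x01] := boolP (0 <= x <= 1).
  by rewrite -(val_insubd_unit x01) ev_val.
rewrite ev_out// uid//; move: x01; rewrite negb_and -!ltNge => /orP[/ltW|/ltW].
  by left.
by right.
Qed.

End RealLine.

(** * Constructing elements: rescaled copies, gluing, the standard generator *)

Section Elements.
Variable R : realType.
Local Notation F := (thompsonF R).
Implicit Types (f g h k : F) (x y t c : R).

Lemma dyadic_nat (n : nat) : dyadic (n%:R : R).
Proof. by exists n%:Z, 0%N; rewrite divr1. Qed.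

Lemma dyadic_half x : dyadic x -> dyadic (x / 2).
Proof.
by move=> [m [k ->]]; exists m, k.+1; rewrite exprSr invfM mulrA.
Qed.

Lemma dyadic_ev f x : dyadic x -> dyadic (ev f x).
Proof.
have [x01 dx|x01] := boolP (0 <= x <= 1); last by rewrite ev_out.
have [[f' [_ f'K _ _]] fo fpl] := thompsonP f.
rewrite -(val_insubd_unit x01) ev_val.
by apply: (thompson_dyadic fo f'K fpl _).1; rewrite val_insubd_unit.
Qed.

(** Conjugation by [x |-> c + 2 ^ n * x], which keeps breakpoints dyadic and does not change slopes.
    It serves with [n = -1] to shrink an element to a half and with [n = 1] to enlarge it again. *)
Lemma affine_conj f (n : int) c : dyadic c ->
  (forall x, x <= 0 \/ 1 <= x -> c + 2 ^ n * ev f (2 ^ (- n) * (x - c)) = x) ->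
  exists g, forall x, ev g x = c + 2 ^ n * ev f (2 ^ (- n) * (x - c)).
Proof.
move=> dc H; have n0 : (0 : R) < 2 ^ n by rewrite exprz_gt0.
have n0' : (0 : R) < 2 ^ (- n) by rewrite exprz_gt0.
have nn : (2 : R) ^ n * 2 ^ (- n) = 1 by rewrite -expfzDr// subrr.
have nn' : (2 : R) ^ (- n) * 2 ^ n = 1 by rewrite -expfzDr// addNr.
have [s sd saff] := ev_affine f.
apply: (@is_thompson_real R _
  (fun x => c + 2 ^ n * ev f^-1%g (2 ^ (- n) * (x - c)))
  [seq c + 2 ^ n * d | d <- s]).
- by move=> x y xy; rewrite ltrD2l ltr_pM2l// ev_lt ltr_pM2l// ltrD2r.
- by move=> x; rewrite addrAC subrr add0r mulrA nn' mul1r evK mulrA nn mul1r addrC subrK.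
- by move=> x; rewrite addrAC subrr add0r mulrA nn' mul1r evVK mulrA nn mul1r addrC subrK.
- exact: H.
- by move=> d /mapP[d' /sd dd' ->]; apply: dyadicD => //; exact: dyadicZ.
move=> a b ab sab.
have [||m mP] := saff (2 ^ (- n) * (a - c)) (2 ^ (- n) * (b - c)).
- by rewrite ler_pM2l// lerD2r.
- move=> d ds; have [|h|h] := sab (c + 2 ^ n * d); first by apply/mapP; exists d.
    by left; rewrite -(ler_pM2l n0) mulrA nn mul1r lerBrDl.
  by right; rewrite -(ler_pM2l n0) mulrA nn mul1r lerBlDl.
exists m => x xab; rewrite mP; last by rewrite !ler_pM2l// !lerD2r.
rewrite mulrDr addrA; congr (_ + _).
rewrite -mulrBr (_ : x - c - (a - c) = x - a); last by ring.
by rewrite mulrCA (mulrA (2 ^ n)) nn mul1r.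
Qed.

(** Prepends the binary digit [b]: the affine map from [[0, 1]] onto its left ([false]) or right
    ([true]) half. *)
Definition bit (b : bool) x : R := (x + b%:R) / 2.
Definition unbit (b : bool) x : R := 2 * x - b%:R.

Lemma bitK b : cancel (bit b) (unbit b).
Proof. by move=> x; rewrite /bit /unbit; field. Qed.

Lemma unbitK b : cancel (unbit b) (bit b).
Proof. by move=> x; rewrite /bit /unbit; field. Qed.

Lemma bit_lt b x y : (bit b x < bit b y) = (x < y).
Proof. by rewrite /bit ltr_pM2r ?ltrD2r// invr_gt0. Qed.

Lemma bit_le b x y : (bit b x <= bit b y) = (x <= y).
Proof. by rewrite !leNgt bit_lt. Qed.

Lemma dyadic_bit b x : dyadic (bit b x) <-> dyadic x.
Proof.
split=> [dx|dx]; last by apply: dyadic_half; apply: dyadicD => //; exact: dyadic_nat.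
rewrite -(bitK b x) /unbit; apply: dyadicD; first exact: (dyadicZ 1).
by apply: dyadicN; exact: dyadic_nat.
Qed.

Lemma zoom_subproof b f : {g : F | forall x, ev g (bit b x) = bit b (ev f x)}.
Proof.
apply: cid; have [|x x01|g gP] := @affine_conj f (-1) (b%:R / 2).
- by apply: dyadic_half; exact: dyadic_nat.
- rewrite opprK (_ : 2 ^ (1 : int) = 2)// (_ : 2 ^ (-1 : int) = 2^-1)//.
  have b01 : 0 <= (b%:R : R) <= 1 by case: b; rewrite /= ?lexx ?ler01.
  case: x01 => h; last by rewrite ev_out1; [field|lra].
  by rewrite ev_out0; [field|lra].
exists g => x; rewrite gP opprK (_ : 2 ^ (1 : int) = 2)// (_ : 2 ^ (-1 : int) = 2^-1)//.
rewrite /bit (_ : 2 * _ = x); first by field.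
by field.
Qed.

(** The copy of [f] on one half of [[0, 1]], extended by the identity. *)
Definition zoom b f : F := sval (zoom_subproof b f).

Lemma zoomE b f x : ev (zoom b f) (bit b x) = bit b (ev f x).
Proof. exact: (svalP (zoom_subproof b f)). Qed.

Lemma zoom_fix b f x : x <= bit b 0 \/ bit b 1 <= x -> ev (zoom b f) x = x.
Proof.
rewrite -(unbitK b x) zoomE !bit_le => -[h|h]; first by rewrite ev_out0.
by rewrite ev_out1.
Qed.

Lemma zoomM b f g : zoom b (f * g)%g = (zoom b f * zoom b g)%g.
Proof. by apply: ev_ext => x; rewrite -(unbitK b x) evM !zoomE evM. Qed.

Lemma zoom1 b : zoom b 1%g = 1%g.
Proof. by apply: ev_ext => x; rewrite -(unbitK b x) zoomE !ev1. Qed.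

Lemma zoomV b f : zoom b f^-1%g = (zoom b f)^-1%g.
Proof.
by apply/eqP; rewrite -mulg_eq1 -zoomM mulVg zoom1.
Qed.

Lemma zoom_onto b f : (forall x, x <= bit b 0 \/ bit b 1 <= x -> ev f x = x) ->
  exists g, f = zoom b g.
Proof.
move=> H; have [||g gP] := @affine_conj f 1 (- b%:R).
- by apply: dyadicN; exact: dyadic_nat.
- rewrite (_ : 2 ^ (1 : int) = 2)// (_ : 2 ^ (-1 : int) = 2^-1)// => x x01.
  rewrite opprK (_ : 2^-1 * _ = bit b x); last by rewrite /bit mulrC.
  by rewrite H ?bit_le// /bit; field.
exists g; apply: ev_ext => x; rewrite -(unbitK b x) zoomE gP.
rewrite (_ : 2 ^ (1 : int) = 2)// (_ : 2 ^ (-1 : int) = 2^-1)//.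
rewrite opprK (_ : 2^-1 * (_ + _) = bit b (unbit b x)); last by rewrite /bit mulrC.
by rewrite /bit; field.
Qed.

Lemma thompson_glue f g c : dyadic c -> ev f c = ev g c ->
  exists h, (forall x, x <= c -> ev h x = ev f x) /\
            (forall x, c <= x -> ev h x = ev g x).
Proof.
move=> dc fgc; have [s sd saff] := ev_affine f; have [t td taff] := ev_affine g.
have [||||||h hP] := @is_thompson_real R
  (fun x => if x <= c then ev f x else ev g x)
  (fun x => if x <= ev f c then ev f^-1%g x else ev g^-1%g x) (c :: s ++ t).
- move=> x y xy /=; case: (leP x c) => xc; case: (leP y c) => yc; rewrite ?ev_lt//.
    by apply: (@le_lt_trans _ _ (ev f c)); rewrite ?ev_le// fgc ev_lt.
  by move: (lt_trans xc xy); rewrite ltNge yc.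
- move=> x /=; case: (leP x c) => xc; rewrite ?ev_le ?xc ?evK//.
  by rewrite fgc leNgt ev_lt xc.
- move=> x /=; case: (leP x (ev f c)) => xc.
    by rewrite -(ev_le f) evVK xc.
  by rewrite leNgt -(ev_lt g) evVK -fgc xc.
- move=> x [h|h]; case: ifP => _; by [rewrite ev_out0|rewrite ev_out1].
- by move=> d; rewrite inE mem_cat => /orP[/eqP->//|/orP[/sd|/td]].
- move=> a b ab H; have [|ca|bc] := H c; first by rewrite inE eqxx.
    have [d dt|n nP] := taff a b ab.
      by apply: H; rewrite !inE mem_cat dt !orbT.
    exists n => x /andP[ax xb]; have := nP x; rewrite ax xb => /(_ isT) E.
    have E' y : c <= y -> (if y <= c then ev f y else ev g y) = ev g y.
      by move=> cy; case: leP => // yc; rewrite (_ : y = c)//; apply/eqP; rewrite eq_le yc.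
    by rewrite !E'// (le_trans ca).
  have [d dt|n nP] := saff a b ab.
    by apply: H; rewrite !inE mem_cat dt !orbT.
  exists n => x /andP[ax xb]; have := nP x; rewrite ax xb => /(_ isT) E.
  by rewrite (le_trans xb bc) (le_trans ab bc).
exists h; split=> x xc; rewrite hP ?xc//.
by case: leP => // xc'; rewrite (_ : x = c)//; apply/eqP; rewrite eq_le xc'.
Qed.

(** The standard generator of F: it carries the intervals cut out by 0, 1/4, 1/2, 1 to those cut out
    by 0, 1/2, 3/4, 1, which is a rotation of binary trees. *)
Definition x0_fun x : R := if x <= 0 then x else if x <= 1 / 4 then 2 * x else
  if x <= 1 / 2 then x + 1 / 4 else if x <= 1 then (x + 1) / 2 else x.

Definition x0_inv x : R := if x <= 0 then x else if x <= 1 / 2 then x / 2 else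
  if x <= 3 / 4 then x - 1 / 4 else if x <= 1 then 2 * x - 1 else x.

Lemma x0_fun_pieces x :
  [/\ x <= 0 -> x0_fun x = x, 0 <= x <= 1 / 4 -> x0_fun x = 2 * x,
      1 / 4 <= x <= 1 / 2 -> x0_fun x = x + 1 / 4,
      1 / 2 <= x <= 1 -> x0_fun x = (x + 1) / 2 & 1 <= x -> x0_fun x = x].
Proof.
rewrite /x0_fun; case: (leP x 0) => h1; first by split; lra.
case: (leP x (1 / 4)) => h2; first by split; lra.
case: (leP x (1 / 2)) => h3; first by split; lra.
by case: (leP x 1) => h4; split; lra.
Qed.

Lemma x0_inv_pieces x :
  [/\ x <= 0 -> x0_inv x = x, 0 <= x <= 1 / 2 -> x0_inv x = x / 2,
      1 / 2 <= x <= 3 / 4 -> x0_inv x = x - 1 / 4,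
      3 / 4 <= x <= 1 -> x0_inv x = 2 * x - 1 & 1 <= x -> x0_inv x = x].
Proof.
rewrite /x0_inv; case: (leP x 0) => h1; first by split; lra.
case: (leP x (1 / 2)) => h2; first by split; lra.
case: (leP x (3 / 4)) => h3; first by split; lra.
by case: (leP x 1) => h4; split; lra.
Qed.

Lemma x0_subproof : {f : F | ev f =1 x0_fun}.
Proof.
apply: cid; apply: (@is_thompson_real R x0_fun x0_inv [:: 0; 1 / 4; 1 / 2; 1]).
- move=> x y xy; rewrite /x0_fun.
  by case: (leP x 0) => ?; [|case: (leP x (1 / 4)) => ?;
    [|case: (leP x (1 / 2)) => ?; [|case: (leP x 1) => ?]]];
  (case: (leP y 0) => ?; [|case: (leP y (1 / 4)) => ?;
    [|case: (leP y (1 / 2)) => ?; [|case: (leP y 1) => ?]]]); lra.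
- move=> x; have [P1 P2 P3 P4 P5] := x0_fun_pieces x.
  have [Q1 Q2 Q3 Q4 Q5] := x0_inv_pieces (x0_fun x).
  have [h1|h1] := leP x 0; first by rewrite Q1 P1.
  have [h2|h2] := leP x (1 / 4); first by rewrite Q2 P2; clear -h1 h2; lra.
  have [h3|h3] := leP x (1 / 2); first by rewrite Q3 P3; clear -h2 h3; lra.
  by have [h4|h4] := leP x 1; [rewrite Q4 P4|rewrite Q5 P5]; clear -h3 h4; lra.
- move=> x; have [P1 P2 P3 P4 P5] := x0_inv_pieces x.
  have [Q1 Q2 Q3 Q4 Q5] := x0_fun_pieces (x0_inv x).
  have [h1|h1] := leP x 0; first by rewrite Q1 P1.
  have [h2|h2] := leP x (1 / 2); first by rewrite Q2 P2; clear -h1 h2; lra.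
  have [h3|h3] := leP x (3 / 4); first by rewrite Q3 P3; clear -h2 h3; lra.
  by have [h4|h4] := leP x 1; [rewrite Q4 P4|rewrite Q5 P5]; clear -h3 h4; lra.
- by move=> x; have [P1 P2 P3 P4 P5] := x0_fun_pieces x; case.
- move=> d; rewrite !inE => /or4P[] /eqP->.
  + exact: (dyadic_nat 0).
  + rewrite (_ : 1 / 4 = 1 / 2 / 2); last by field.
    by do 2!apply: dyadic_half; exact: (dyadic_nat 1).
  + by apply: dyadic_half; exact: (dyadic_nat 1).
  + exact: (dyadic_nat 1).
move=> a b ab H.
have slope n : (forall x, a <= x <= b -> x0_fun x - x0_fun a = 2 ^ n * (x - a)) ->
    exists n : int, forall x, a <= x <= b -> x0_fun x = x0_fun a + 2 ^ n * (x - a).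
  by move=> E; exists n => x /E <-; rewrite addrC subrK.
have [A1 A2 A3 A4 A5] := x0_fun_pieces a.
(* The breakpoints are examined from left to right; the first one that lies at or beyond [b] selects
   the formula valid on all of [[a, b]]. *)
have [|H0|H0] := H 0; rewrite ?inE ?eqxx ?orbT//; last first.
  apply: (slope 0) => x /andP[ax xb]; have [X1 _ _ _ _] := x0_fun_pieces x.
  by rewrite expr0z A1 ?X1; clear -ab ax xb H0; lra.
have [|H1|H1] := H (1 / 4); rewrite ?inE ?eqxx ?orbT//; last first.
  apply: (slope 1) => x /andP[ax xb]; have [_ X2 _ _ _] := x0_fun_pieces x.
  by rewrite expr1z A2 ?X2; clear -ab ax xb H0 H1; lra.
have [|H2|H2] := H (1 / 2); rewrite ?inE ?eqxx ?orbT//; last first.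
  apply: (slope 0) => x /andP[ax xb]; have [_ _ X3 _ _] := x0_fun_pieces x.
  by rewrite expr0z A3 ?X3; clear -ab ax xb H1 H2; lra.
have [|H3|H3] := H 1; rewrite ?inE ?eqxx ?orbT//; last first.
  apply: (slope (-1)) => x /andP[ax xb]; have [_ _ _ X4 _] := x0_fun_pieces x.
  by rewrite exprN1 A4 ?X4; clear -ab ax xb H2 H3; lra.
apply: (slope 0) => x /andP[ax xb]; have [_ _ _ _ X5] := x0_fun_pieces x.
by rewrite expr0z A5 ?X5; clear -ab ax xb H3; lra.
Qed.

Definition x0 : F := sval x0_subproof.

Lemma x0E x : ev x0 x = x0_fun x.
Proof. exact: (svalP x0_subproof). Qed.

Lemma ev_expgS f n x : ev (f ^+ n.+1)%g x = ev f (ev (f ^+ n)%g x).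
Proof. by rewrite expgS evM. Qed.

(** Otherwise the orbit of [c] is bounded by [b]. Its supremum is moved up, so the preimage of the
    supremum lies below some orbit point, and the image of that point exceeds the supremum. *)
Lemma ev_escape f c b : (forall t, c <= t <= b -> t < ev f t) ->
  exists n, b < ev (f ^+ n)%g c.
Proof.
move=> H; apply: contrapT => /forallNP nb.
pose A := range (fun n => ev (f ^+ n)%g c).
have Ac : A c by exists 0%N => //; rewrite expg0 ev1.
have Ab : ubound A b by move=> _ [n _ <-]; rewrite leNgt; apply/negP.
have As : has_sup A by split; [exists c|exists b].
have cs : c <= sup A by apply: ub_le_sup Ac; exists b.
have sb : sup A <= b by apply: ge_sup => //; exists c.
have sf : ev f^-1%g (sup A) < sup A.
  by rewrite -(ev_lt f) evVK H// cs.
have [_ [n _ <-]] := sup_gt As.1 sf.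
rewrite -(ev_lt f) evVK -ev_expgS => sn.
suff : ev (f ^+ n.+1)%g c <= sup A by rewrite leNgt sn.
by apply: ub_le_sup; [exists b|exists n.+1].
Qed.

End Elements.

(** * Tree pairs *)

Inductive tree := Leaf | Node of tree & tree.

Fixpoint leaves (T : tree) : seq (seq bool) :=
  if T is Node A B then map (cons false) (leaves A) ++ map (cons true) (leaves B)
  else [:: [::]].

Fixpoint full n := if n is n'.+1 then Node (full n') (full n') else Leaf.

(** The right comb with [n] carets, the normal form to which all trees are brought. *)
Fixpoint vine n := if n is n'.+1 then Node Leaf (vine n') else Leaf.

Lemma size_full n u : u \in leaves (full n) -> size u = n.
Proof.
elim: n u => [|n IH] u /=; first by rewrite inE => /eqP->.
by rewrite mem_cat => /orP[] /mapP[v /IH <- ->].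
Qed.

Section TreePairs.
Variable R : realType.
Local Notation F := (thompsonF R).
Implicit Types (f g h k : F) (x y t c : R) (w u v : seq bool) (ws us vs : seq (seq bool)).

(** The affine map from [[0, 1]] onto the standard dyadic interval with address [w], the first
    letter being the coarsest digit. *)
Definition word w x : R := foldr (@bit R) x w.

Definition maps_word f u v := forall x, 0 <= x <= 1 -> ev f (word u x) = word v x.

Fixpoint maps_words f us vs : Prop :=
  match us, vs with
  | [::], [::] => True
  | u :: us', v :: vs' => maps_word f u v /\ maps_words f us' vs'
  | _, _ => False
  end.

Lemma bit01 b x : 0 <= x <= 1 -> 0 <= bit b x <= 1.
Proof. by rewrite /bit; case: b => /=; lra. Qed.

Lemma word01 w x : 0 <= x <= 1 -> 0 <= word w x <= 1.
Proof. by move=> x01; elim: w => //= b w IH; exact: bit01. Qed.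

Lemma word_lt w x y : (word w x < word w y) = (x < y).
Proof. by elim: w => //= b w <-; rewrite bit_lt. Qed.

Lemma maps_words_size f us vs : maps_words f us vs -> size us = size vs.
Proof. by elim: us vs => [|u us IH] [|v vs] //= [_ /IH->]. Qed.

Lemma maps_words_cat f us vs us' vs' : maps_words f us vs ->
  maps_words f us' vs' -> maps_words f (us ++ us') (vs ++ vs').
Proof. by elim: us vs => [|u us IH] [|v vs] //= [uv /IH h] /h. Qed.

Lemma maps_words_map f g (p q : seq bool -> seq bool) us vs :
  (forall u v, maps_word f u v -> maps_word g (p u) (q v)) ->
  maps_words f us vs -> maps_words g (map p us) (map q vs).
Proof. by move=> fg; elim: us vs => [|u us IH] [|v vs] //= [/fg ? /IH]. Qed.

Lemma maps_words_same f (p q : seq bool -> seq bool) ws :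
  (forall w, maps_word f (p w) (q w)) -> maps_words f (map p ws) (map q ws).
Proof. by move=> fpq; elim: ws. Qed.

Lemma maps_words_comp f g us vs ws : maps_words f us vs -> maps_words g vs ws ->
  maps_words (g * f)%g us ws.
Proof.
elim: us vs ws => [|u us IH] [|v vs] [|w ws] //= [fuv /IH h] [gvw /h ?].
by split=> // x x01; rewrite evM fuv// gvw.
Qed.

Lemma maps_words_inv f us vs : maps_words f us vs -> maps_words f^-1%g vs us.
Proof.
elim: us vs => [|u us IH] [|v vs] //= [fuv /IH h]; split=> // x x01.
by rewrite -fuv// evK.
Qed.

Lemma maps_words_node f g A B C D :
  maps_words f (leaves A) (leaves C) -> maps_words g (leaves B) (leaves D) ->
  maps_words (zoom false f * zoom true g)%g (leaves (Node A B)) (leaves (Node C D)).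
Proof.
move=> fAC gBD; apply: maps_words_cat; [apply: maps_words_map fAC|apply: maps_words_map gBD].
  move=> u v fuv x x01 /=; rewrite evM (@zoom_fix _ true) ?zoomE ?fuv//; left.
  by rewrite /bit/=; have := word01 u x01; lra.
move=> u v guv x x01 /=; rewrite evM zoomE guv// zoom_fix//; right.
by rewrite /bit/=; have := word01 v x01; lra.
Qed.

Lemma x0_bit00 x : 0 <= x <= 1 -> ev (x0 R) (bit false (bit false x)) = bit false x.
Proof.
move=> x01; rewrite x0E.
have [_ P _ _ _] := x0_fun_pieces (bit false (bit false x)).
by rewrite P /bit/=; clear P; lra.
Qed.

Lemma x0_bit01 x : 0 <= x <= 1 -> ev (x0 R) (bit false (bit true x)) = bit true (bit false x).
Proof.
move=> x01; rewrite x0E.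
have [_ _ P _ _] := x0_fun_pieces (bit false (bit true x)).
by rewrite P /bit/=; clear P; lra.
Qed.

Lemma x0_bit1 x : 0 <= x <= 1 -> ev (x0 R) (bit true x) = bit true (bit true x).
Proof.
move=> x01; rewrite x0E.
have [_ _ _ P _] := x0_fun_pieces (bit true x).
by rewrite P /bit/=; clear P; lra.
Qed.

(** [x0] sends the addresses 00, 01 and 1 to 0, 10 and 11, hence rotates at the root whatever
    subtrees hang there. *)
Lemma maps_words_rot A B C :
  maps_words (x0 R) (leaves (Node (Node A B) C)) (leaves (Node A (Node B C))).
Proof.
rewrite /= !map_cat -!map_comp -catA; apply: maps_words_cat.
  by apply: maps_words_same => w x x01 /=; rewrite x0_bit00// word01.
apply: maps_words_cat; apply: maps_words_same => w x x01 /=.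
  by rewrite x0_bit01// word01.
by rewrite x0_bit1// word01.
Qed.

Lemma leaves_cover T x : 0 <= x <= 1 ->
  exists2 u, u \in leaves T & exists2 y, 0 <= y <= 1 & x = word u y.
Proof.
elim: T x => [|A IHA B IHB] x x01 /=.
  by exists [::]; [rewrite inE|exists x].
have [h|h] := leP x (1 / 2).
  have [|u uA [y y01 xy]] := IHA (unbit false x); first by rewrite /unbit/=; lra.
  exists (false :: u); first by rewrite mem_cat map_f.
  by exists y => //=; rewrite -[word u y]/(word u y) -xy unbitK.
have [|u uB [y y01 xy]] := IHB (unbit true x); first by rewrite /unbit/=; lra.
exists (true :: u); first by rewrite mem_cat map_f ?orbT.
by exists y => //=; rewrite -xy unbitK.
Qed.

Lemma maps_words_inj f g T vs : maps_words f (leaves T) vs ->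
  maps_words g (leaves T) vs -> f = g.
Proof.
move=> fT gT; apply: ev_ext => x.
have [x01|x01] := boolP (0 <= x <= 1); last by rewrite !ev_out.
have [u + [y y01 ->]] := leaves_cover T x01.
elim: (leaves T) vs fT gT => [|w ws IH] [|v vs] //= [fwv fT] [gwv gT].
by rewrite inE => /predU1P[->|/(IH _ fT gT)//]; rewrite fwv ?gwv.
Qed.

(** The intervals addressed by [ws] are adjacent, in order, and fill [[a, b]]. *)
Fixpoint tile (a : R) ws (b : R) : Prop :=
  if ws is w :: ws' then word w 0 = a /\ tile (word w 1) ws' b else a = b.

Lemma tile_cat a ws ws' b :
  tile a (ws ++ ws') b <-> exists2 c, tile a ws c & tile c ws' b.
Proof.
elim: ws a => [|w ws IH] a /=.
  by split=> [h|[c ->]//]; exists a.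
split=> [[wa /IH[c h1 h2]]|[c [wa h1] h2]]; first by exists c.
by split=> //; apply/IH; exists c.
Qed.

Lemma tile_lt a ws b : tile a ws b -> ws != [::] -> a < b.
Proof.
elim: ws a => // w ws IH a [<- h] _; have w01 : word w 0 < word w 1 by rewrite word_lt.
by case: ws IH h => [_ <-//|v ws IH h]; apply: lt_trans w01 (IH _ h isT).
Qed.

Lemma tile_nil a ws : tile a ws a -> ws = [::].
Proof. by move=> h; apply/eqP/negPn/negP => /(tile_lt h); rewrite ltxx. Qed.

Lemma tile_map b a ws c : tile a ws c -> tile (bit b a) (map (cons b) ws) (bit b c).
Proof. by elim: ws a => [|w ws IH] a /=; [move->|case=> <- /IH]. Qed.

Lemma tile_leaves T : tile 0 (leaves T) 1.
Proof.
elim: T => [//|A IHA B IHB] /=; apply/tile_cat; exists (1 / 2).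
  have := tile_map false IHA; rewrite (_ : bit false 0 = 0); last by rewrite /bit/=; field.
  by rewrite (_ : bit false 1 = 1 / 2)// /bit/=; field.
have := tile_map true IHB; rewrite (_ : bit true 1 = 1); last by rewrite /bit/=; field.
by rewrite (_ : bit true 0 = 1 / 2)// /bit/=; field.
Qed.

Lemma tile_maps_words f a us b vs : tile a us b -> maps_words f us vs ->
  tile (ev f a) vs (ev f b).
Proof.
elim: us a vs => [|u us IH] a [|v vs] //=; first by move=> ->.
by move=> [<- h] [fuv /IH H]; rewrite -!fuv ?lexx ?ler01//; split=> //; exact: H.
Qed.

Lemma tile_upper a ws : [::] \notin ws -> 1 / 2 <= a -> tile a ws 1 ->
  exists2 us, ws = map (cons true) us & tile (unbit true a) us 1.
Proof.
elim: ws a => [|[|b w] ws IH] a //=; rewrite ?inE//.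
  by move=> _ _ ->; exists [::] => //=; rewrite /unbit/=; field.
move=> nws a2 [wa h]; case: b nws wa h => nws wa h; last first.
  suff : bit false (word w 1) <= 1 / 2 /\ word w 0 < word w 1.
    by move: wa a2; rewrite /bit/=; lra.
  rewrite word_lt ltr01; split=> //.
  by have := @word01 w 1; rewrite lexx ler01 /bit/= => /(_ isT); lra.
have [//||us -> hus] := IH _ _ _ h.
  by have := @word01 w 1; rewrite lexx ler01 /bit/= => /(_ isT); lra.
exists (w :: us) => //=; rewrite -wa bitK; split=> //.
by move: hus; rewrite bitK.
Qed.

(** The interval of a nonempty address stays inside one half, so a tiling that starts in the left
    half and reaches 1 has a cut at 1/2. *)
Lemma tile_lower a ws : [::] \notin ws -> a <= 1 / 2 -> tile a ws 1 ->
  exists us vs, [/\ ws = map (cons false) us ++ map (cons true) vs,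
    tile (unbit false a) us 1 & tile 0 vs 1].
Proof.
elim: ws a => [|[|b w] ws IH] a nws a2 H //.
  by move: a2; rewrite H => ?; exfalso; lra.
case: b nws H => nws [/= wa h].
  have a2' : a = 1 / 2.
    apply/eqP; rewrite eq_le a2 -wa /bit/=.
    by have := @word01 w 0; rewrite lexx ler01 => /(_ isT); lra.
  have [||vs -> hvs] := @tile_upper a ((true :: w) :: ws) nws; first by rewrite a2'.
    by split.
  exists [::], vs; split=> //=; first by rewrite a2' /unbit/=; field.
  by move: hvs; rewrite a2' (_ : unbit true (1 / 2) = 0)// /unbit/=; field.
move: nws; rewrite inE /= => nws.
have [//||us [vs [-> hus hvs]]] := IH _ _ _ h.
  by have := @word01 w 1; rewrite lexx ler01 /bit/= => /(_ isT); lra.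
exists (w :: us), vs; split=> //=; rewrite -wa bitK; split=> //.
by move: hus; rewrite bitK.
Qed.

(** Induction on the longest address. If the empty address occurs, it is the only tile; otherwise
    the tiling is cut at 1/2 and each half comes from a subtree. *)
Lemma tile_tree ws : tile 0 ws 1 -> exists T, leaves T = ws.
Proof.
have leaf vs : [::] \in vs -> tile 0 vs 1 -> leaves Leaf = vs.
  move=> /splitPr[us {}vs] /tile_cat[c hc /= [c0 hv]].
  by move: hc hv; rewrite -c0 => /tile_nil-> /tile_nil->.
have [n] : exists n, all (fun w => size w <= n)%N ws.
  exists (foldr maxn 0%N (map size ws)); elim: ws => //= w ws IH.
  rewrite leq_maxl/=; apply: sub_all IH => v h.
  by rewrite leq_max h orbT.
elim: n ws => [|n IH] ws sws H; have [nws|nws] := boolP ([::] \in ws);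
  try by exists Leaf; exact: leaf.
  case: ws sws H nws => [_ /eqP|[|//] ws]; first by rewrite eq_sym oner_eq0.
  by rewrite inE.
have [|us [vs [wsE hus hvs]]] := tile_lower nws _ H; first by lra.
have [||A hA] := IH us.
- by move: sws; rewrite wsE all_cat => /andP[+ _]; rewrite all_map.
- by move: hus; rewrite /unbit/= mulr0 subr0.
have [|//|B hB] := IH vs.
  by move: sws; rewrite wsE all_cat => /andP[_]; rewrite all_map.
by exists (Node A B); rewrite /= hA hB.
Qed.

Lemma wordE u : exists2 j : nat, (j < 2 ^ size u)%N &
  forall x, word u x = (x + j%:R) / 2 ^+ size u.
Proof.
elim: u => [|b u [j ju uE]] /=.
  by exists 0%N => // x; rewrite addr0 divr1.
exists (b * 2 ^ size u + j)%N => [|x].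
  by rewrite expnS mul2n -addnn; case: b; rewrite ?mul1n ?mul0n ?ltn_add2l// ltn_addr.
rewrite uE /bit natrD natrM natrX exprS.
have p0 : (2 ^+ size u : R) != 0 by rewrite expf_neq0.
by field.
Qed.

Lemma word_onto M (j : nat) : (j < 2 ^ M)%N ->
  exists v, forall x, word v x = (x + j%:R) / 2 ^+ M.
Proof.
elim: M j => [|M IH] j.
  by rewrite expn0 ltnS leqn0 => /eqP->; exists [::] => x; rewrite addr0 divr1.
have p0 : (2 ^+ M : R) != 0 by rewrite expf_neq0.
rewrite expnS mul2n -addnn => jM; have [h|h] := ltnP j (2 ^ M).
  have [v vE] := IH _ h; exists (false :: v) => x.
  by rewrite /= vE /bit exprS /=; field.
have [|v vE] := IH (j - 2 ^ M)%N; first by rewrite ltn_subLR.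
exists (true :: v) => x.
by rewrite /= vE /bit natrB// natrX exprS /=; field.
Qed.

(** All sufficiently fine standard dyadic intervals inside [[a, b]] are carried affinely onto
    standard dyadic intervals. *)
Definition tame f (a b : R) := exists n, forall u, (n <= size u)%N ->
  a <= word u 0 -> word u 1 <= b -> exists v, maps_word f u v.

Lemma tame_cat f a b c : dyadic b -> tame f a b -> tame f b c -> tame f a c.
Proof.
(* Depth at least [k] puts [b = m / 2 ^ k] on the grid, so the interval of [u] cannot straddle it;
   [n1] and [n2] serve the two sides. *)
move=> [m [k ->]] [n1 H1] [n2 H2]; exists (k + (n1 + n2))%N => u hu au uc.
have [j _ uE] := wordE u.
have p0 : (0 : R) < 2 ^+ size u by rewrite exprn_gt0.
have k0 : (2 ^+ k : R) != 0 by rewrite expf_neq0.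
have bE : m%:~R / 2 ^+ k = (m * 2 ^+ (size u - k))%:~R / 2 ^+ size u :> R.
  rewrite rmorphM rmorphXn/= -{2}(@subnKC k (size u)); last first.
    by apply: leq_trans hu; rewrite leq_addr.
  by rewrite exprD; field; rewrite k0 expf_neq0.
have [h|h] := leP (j%:Z + 1) (m * 2 ^+ (size u - k)).
  apply: H1 => //; first by apply: leq_trans hu; rewrite addnCA leq_addr.
  rewrite bE uE ler_pM2r ?invr_gt0//.
  by rewrite addrC -[1 in leLHS]/(1%:~R) -[j%:R]/(j%:~R) -rmorphD/= ler_int.
apply: H2 => //; first by apply: leq_trans hu; rewrite addnA leq_addl.
rewrite bE uE ler_pM2r ?invr_gt0// add0r -[j%:R]/(j%:~R) ler_int.
by move: h; rewrite ltzD1.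
Qed.

Lemma tame_affine f a b (n : int) : dyadic a ->
  (forall x, a <= x <= b -> ev f x = ev f a + 2 ^ n * (x - a)) -> tame f a b.
Proof.
move=> da H.
have [m [k cE]] : dyadic (ev f a - 2 ^ n * a).
  by apply: dyadicD; [exact: dyadic_ev|apply/dyadicN/dyadicZ].
(* With [f x = 2 ^ n * x + m / 2 ^ k], interval number [j] at depth [size u] goes to number
   [i = j + m * 2 ^ (M - k)] at depth [M = size u - n]; the bound on the depth gives [k <= M]. *)
exists (k + `|n|)%N => u hu au ub; have [j _ uE] := wordE u.
have [M ME] : exists M : nat, M%:Z = (size u)%:Z - n.
  exists `|(size u)%:Z - n|%N; rewrite gez0_abs// subr_ge0.
  apply: le_trans (lez_abs n) _; rewrite lez_nat.
  by apply: leq_trans hu; rewrite leq_addl.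
have kM : (k <= M)%N.
  rewrite -lez_nat ME lerBrDr; apply: (@le_trans _ _ (k + `|n|)%N%:Z); last by rewrite lez_nat.
  by rewrite PoszD lerD2l lez_abs.
have p0 : (0 : R) < 2 ^+ M by rewrite exprn_gt0.
pose i : int := j%:Z + m * 2 ^+ (M - k).
have fu x : 0 <= x <= 1 -> ev f (word u x) = (x + i%:~R) / 2 ^+ M.
  move=> /andP[x0' x1]; rewrite H; last first.
    have le z y : z <= y -> word u z <= word u y by rewrite leNgt -(word_lt u) -leNgt.
    by rewrite (le_trans au) ?(le_trans _ ub)// le.
  rewrite mulrBr addrA addrAC (_ : ev f a - _ = m%:~R / 2 ^+ k)//.
  have nE : 2 ^ n = 2 ^+ size u / 2 ^+ M :> R.
    have -> : n = (size u)%:Z - M%:Z by rewrite ME opprB addrC subrK.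
    by rewrite expfzDr// -invr_expz.
  rewrite uE nE /i rmorphD rmorphM rmorphXn/=.
  have s0 : (2 ^+ size u : R) != 0 by rewrite expf_neq0.
  have k0 : (2 ^+ k : R) != 0 by rewrite expf_neq0.
  have Mk : (2 ^+ (M - k) : R) != 0 by rewrite expf_neq0.
  rewrite -(subnKC kM) addKn exprD -[j%:~R]/(j%:R); field.
  by rewrite s0 k0 Mk.
have i0 : 0 <= i.
  have : 0 <= ev f (word u 0).
    by have := @word01 u 0; rewrite lexx ler01 => /(_ isT)/(ev_range f)/andP[].
  by rewrite fu ?lexx ?ler01// pmulr_lge0 ?invr_gt0// add0r ler0z.
have i1 : i + 1 <= (2 ^ M)%N%:Z.
  have : ev f (word u 1) <= 1.
    by have := @word01 u 1; rewrite lexx ler01 => /(_ isT)/(ev_range f)/andP[].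
  rewrite fu ?lexx ?ler01// ler_pdivrMr// mul1r -natrX addrC.
  by rewrite -[1 in leLHS]/(1%:~R) -rmorphD -[(2 ^ M)%:R]/((2 ^ M)%N%:~R) ler_int.
have iM : (`|i| < 2 ^ M)%N by rewrite -ltz_nat gez0_abs// -lezD1.
have [v vE] := word_onto iM; exists v => x x01.
by rewrite fu// vE -[`|i|%:R]/(`|i|%N%:~R) gez0_abs.
Qed.

(** Induction on the number of breakpoints inside the interval: cut at one of them, which is
    dyadic. *)
Lemma tame01 f : tame f 0 1.
Proof.
have [s sd saff] := ev_affine f.
suff H (n : nat) (a b : R) : (count (fun d => a < d < b)%R s <= n)%N -> a <= b -> dyadic a ->
    tame f a b.
  by apply: (H _ 0 1 (leqnn _)) => //; exact: (dyadic_nat _ 0).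
elim: n a b => [|n IH] a b sn ab da;
    (have [/hasP[d ds /andP[ad db]]|nh] := boolP (has (fun d => a < d < b) s); last first).
- have [d ds|m mP] := saff a b ab; last exact: tame_affine mP.
  have /hasPn/(_ d ds) := nh; rewrite negb_and -!leNgt => /orP[]; by [left|right].
- by move: sn; rewrite leqNgt -has_count => /hasPn/(_ d ds); rewrite ad db.
- have [d ds|m mP] := saff a b ab; last exact: tame_affine mP.
  have /hasPn/(_ d ds) := nh; rewrite negb_and -!leNgt => /orP[]; by [left|right].
- apply: (@tame_cat _ _ d); first exact: sd.
    apply: IH => //; rewrite ?(ltW ad)// -ltnS; apply: leq_trans sn.
    apply: (count_lt _ ds); rewrite ?ad ?db ?ltxx ?andbF//.
    by move=> z /andP[-> /lt_trans->].
  apply: IH; rewrite ?(ltW db)//; last exact: sd.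
  rewrite -ltnS; apply: leq_trans sn.
  apply: (count_lt _ ds); rewrite ?ad ?db ?ltxx//.
  by move=> z /andP[/(lt_trans ad)-> ->].
Qed.

(** The leaves of a deep enough full tree go to standard intervals that tile [[0, 1]], hence to the
    leaves of a tree. *)
Lemma tree_pair f : exists A B, maps_words f (leaves A) (leaves B).
Proof.
have [n nP] := tame01 f; exists (full n).
have [vs h] : exists vs, maps_words f (leaves (full n)) vs.
  have : forall u, u \in leaves (full n) -> exists v, maps_word f u v.
    move=> u /size_full un; apply: nP; first by rewrite un.
      by have := @word01 u 0; rewrite lexx ler01 => /(_ isT)/andP[].
    by have := @word01 u 1; rewrite lexx ler01 => /(_ isT)/andP[].
  elim: (leaves _) => [|u us IH] H; first by exists [::].
  have [v uv] := H u (mem_head _ _).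
  have [|vs uvs] := IH; first by move=> w wu; apply: H; rewrite inE wu orbT.
  by exists (v :: vs).
have := tile_maps_words (tile_leaves (full n)) h.
by rewrite ev_out0// ev_out1// => /tile_tree[T TE]; exists T; rewrite TE.
Qed.

(** Every tree pair factors through a vine, and a tree becomes a vine by rotations at its nodes,
    which are zoomed copies of [x0]. *)
Lemma zoom_closed_full (H : set F) : is_subgroup H -> H (x0 R) ->
  (forall b f, H f -> H (zoom b f)) -> forall f, H f.
Proof.
move=> [H1 HM HV] Hx Hz f.
(* A rotation at the root detaches the first leaf of the left vine; the remaining two vines are
   merged inside the right half. *)
have merge a b : exists2 h, H h &
    maps_words h (leaves (Node (vine a) (vine b))) (leaves (vine (a + b).+1)).
  elim: a => [|a [h Hh hab]].
    by exists 1%g => //; rewrite -[X in maps_words _ X _]map_id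
      -[X in maps_words _ _ X]map_id; apply: maps_words_same => w x _; rewrite ev1.
  exists ((zoom false 1 * zoom true h) * x0 R)%g.
    by apply: (HM) => //; apply: (HM); apply: Hz.
  apply: maps_words_comp (maps_words_rot Leaf (vine a) (vine b)) _.
  apply: maps_words_node => //=; split=> // x _; exact: ev1.
have toV T : exists2 h, H h & exists n, maps_words h (leaves T) (leaves (vine n)).
  elim: T => [|A [h Hh [a hA]] B [k Hk [b kB]]].
    by exists 1%g => //; exists 0%N; split=> // x _; exact: ev1.
  have [m Hm mab] := merge a b.
  exists (m * (zoom false h * zoom true k))%g; first by apply: (HM) => //; apply: (HM); exact: Hz.
  by exists (a + b).+1; apply: maps_words_comp mab; exact: maps_words_node.
have [A [B fAB]] := tree_pair f.
have [h Hh [a hA]] := toV A; have [k Hk [b kB]] := toV B.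
have sv n : size (leaves (vine n)) = n.+1.
  by elim: n => //= n IH; rewrite size_map IH.
(* The two trees of [f] have equally many leaves, so they reduce to the same vine. *)
have ab : a = b.
  apply/eqP; rewrite -eqSS -!sv -(maps_words_size hA) -(maps_words_size kB).
  by rewrite (maps_words_size fAB).
rewrite ab in hA.
have hB := maps_words_comp hA (maps_words_inv kB).
by rewrite -(maps_words_inj hB fAB); apply: (HM) => //; exact: HV.
Qed.

End TreePairs.

(** * Generators *)

Section Subgroups.
Local Open Scope group_scope.
Variable G : groupType.
Implicit Types (x y z : G) (X H K : set G).

Lemma generated_sub X H : is_subgroup H -> X `<=` H -> generated X `<=` H.
Proof. by move=> sH XH x; apply; split. Qed.

Lemma sub_generated X : X `<=` generated X.
Proof. exact: sub_gen_smallest. Qed.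

Lemma subgroupI H K : is_subgroup H -> is_subgroup K -> is_subgroup (H `&` K).
Proof.
move=> [H1 HM HV] [K1 KM KV]; split=> // [x y [? ?] [? ?]|x [? ?]].
  by split; [exact: HM|exact: KM].
by split; [exact: HV|exact: KV].
Qed.

Lemma subgroupJ H x y : is_subgroup H -> H x -> H y -> H (x ^ y).
Proof. by move=> [_ HM HV] Hx Hy; apply: (HM); [exact: HV|exact: HM]. Qed.

Lemma subgroupR H x y : is_subgroup H -> H x -> H y -> H [~ x, y].
Proof.
by move=> sH Hx Hy; have [_ HM HV] := sH; apply: HM; [exact: HV|exact: subgroupJ].
Qed.

Lemma subgroupX H x n : is_subgroup H -> H x -> H (x ^+ n).
Proof.
by move=> [H1 HM _] Hx; elim: n => // n IH; rewrite expgS; exact: HM.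
Qed.

Lemma subgroup_preim (G' : groupType) (f : G' -> G) H :
  {morph f : u v / u * v} -> is_subgroup H ->
  is_subgroup (fun u => H (f u)).
Proof.
move=> fM [H1 HM HV]; have f1 : f 1 = 1.
  by apply: (mulgI (f 1)); rewrite -fM !mulg1.
split=> [|u v Hu Hv|u Hu]; rewrite ?f1// ?fM; first exact: HM.
have -> : f u^-1 = (f u)^-1 by apply/eqP; rewrite -mulg_eq1 -fM mulVg f1.
exact: HV.
Qed.

(** The derived series, starting with the whole group at index 0. *)
Fixpoint der n : set G := if n is n'.+1 then
  generated [set z | exists x y, [/\ der n' x, der n' y & z = [~ x, y]]] else setT.

Lemma der_subgroup n : is_subgroup (der n).
Proof. by case: n => // n; exact: generated_subgroup. Qed.

Lemma der_commg n x y : der n x -> der n y -> der n.+1 [~ x, y].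
Proof. by move=> dx dy; apply: sub_generated; exists x, y. Qed.

Lemma derJ n x y : der n x -> der n (x ^ y).
Proof.
elim: n x => // n IH x; apply: (@generated_sub _ (fun u => der n.+1 (u ^ y))).
  exact: (subgroup_preim (fun u v => conjMg u v y) (der_subgroup n.+1)).
by move=> _ [u [v [du dv ->]]]; rewrite conjRg; apply: der_commg; exact: IH.
Qed.

Lemma der_sub n H K : is_subgroup K -> der n `<=` H ->
  (forall x y, H x -> H y -> K [~ x, y]) -> der n.+1 `<=` K.
Proof.
move=> sK nH HK; apply: generated_sub => // _ [x [y [dx dy ->]]].
by apply: HK; exact: nH.
Qed.

Lemma der1_derived : der 1 `<=` @derived_subgroup G.
Proof.
apply: generated_sub; first exact: generated_subgroup.
by move=> _ [x [y [_ _ ->]]]; exact: derived_commg.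
Qed.

End Subgroups.

(** * Two generators of Thompson's group *)

Section Generators.
Local Open Scope group_scope.
Variable R : realType.
Local Notation F := (thompsonF R).
Local Notation a := (x0 R).
Local Notation c := (zoom true (x0 R)).
Local Notation b := (zoom false (x0 R)).
Implicit Types (f g h k : F) (x y t : R) (w u v : seq bool).

Definition zoomw w f : F := foldr (@zoom R) f w.

Lemma zoomwE w f x : ev (zoomw w f) (word w x) = word w (ev f x).
Proof. by elim: w => //= d w IH; rewrite zoomE IH. Qed.

Lemma zoomwM w f g : zoomw w (f * g) = zoomw w f * zoomw w g.
Proof. by elim: w => //= d w ->; rewrite zoomM. Qed.

Lemma word_bij w : exists z, cancel z (@word R w).
Proof.
elim: w => [|d w [z zK]]; first by exists id.
by exists (z \o unbit d) => x /=; rewrite zK unbitK.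
Qed.

Lemma word_le w x y : (word w x <= word w y)%R = (x <= y)%R.
Proof. by rewrite !leNgt word_lt. Qed.

Lemma zoomw_fix w f x : (x <= word w 0 \/ word w 1 <= x)%R -> ev (zoomw w f) x = x.
Proof.
have [z zK] := word_bij w; rewrite -(zK x) zoomwE !word_le.
by case=> h; [rewrite ev_out0|rewrite ev_out1].
Qed.

(** On the interval of [u], the map [h] is the affine identification with the interval of [v];
    elsewhere both sides are trivial. *)
Lemma zoomwJ h u v f : maps_word h u v -> zoomw u f = zoomw v f ^ h.
Proof.
move=> huv; apply: (mulgI h); rewrite conjgE mulVKg; apply: ev_ext => x.
rewrite !evM; have [z zK] := word_bij u; rewrite -(zK x) zoomwE.
have hout t : (t <= 0 -> ev h (word u t) <= word v 0)%R /\
              (1 <= t -> word v 1 <= ev h (word u t))%R.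
  by rewrite -!huv ?lexx ?ler01// !ev_le !word_le.
have [/andP[z0 z1]|] := boolP (0 <= z x <= 1)%R.
  by rewrite !huv ?z0 ?z1 ?zoomwE// ev_range// z0.
rewrite negb_and -!ltNge => /orP[/ltW h0|/ltW h1].
  by rewrite (@ev_out0 _ f)// zoomw_fix//; left; exact: (hout _).1.
by rewrite (@ev_out1 _ f)// zoomw_fix//; right; exact: (hout _).2.
Qed.

Lemma x0_maps00 u : maps_word a (false :: false :: u) (false :: u).
Proof. by move=> x x01 /=; rewrite x0_bit00// word01. Qed.

Lemma x0_maps01 u : maps_word a (false :: true :: u) (true :: false :: u).
Proof. by move=> x x01 /=; rewrite x0_bit01// word01. Qed.

Lemma x0_maps1 u : maps_word a (true :: u) (true :: true :: u).
Proof. by move=> x x01 /=; rewrite x0_bit1// word01. Qed.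

Lemma maps_word_comp g h u v w : maps_word g u v -> maps_word h v w ->
  maps_word (h * g) u w.
Proof. by move=> guv hvw x x01; rewrite evM guv// hvw. Qed.

Lemma maps_word_inv g u v : maps_word g u v -> maps_word g^-1 v u.
Proof. by move=> guv x x01; rewrite -guv// evK. Qed.

Lemma maps_word_zoom d g u v : maps_word g u v ->
  maps_word (zoom d g) (d :: u) (d :: v).
Proof. by move=> guv x x01; rewrite /= zoomE guv. Qed.

(** Both sides turn the left comb with four leaves into the right comb: two rotations one way round
    the pentagon, three the other way. *)
Lemma pentagon : a * a = c * a * b.
Proof.
have rid A : maps_words (1 : F) (leaves A) (leaves A).
  by elim: (leaves A) => //= w ws IH; split=> // x _; rewrite ev1.
pose rot := @maps_words_rot R.
have h1 := maps_words_comp (rot (Node Leaf Leaf) Leaf Leaf) (rot Leaf Leaf (Node Leaf Leaf)).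
have h2 := maps_words_node (rot Leaf Leaf Leaf) (rid Leaf).
have h3 := maps_words_node (rid Leaf) (rot Leaf Leaf Leaf).
rewrite zoom1 mulg1 in h2; rewrite zoom1 mul1g in h3.
have h4 := maps_words_comp h2 (maps_words_comp (rot _ (Node Leaf Leaf) _) h3).
exact: maps_words_inj h1 h4.
Qed.

(** The pentagon expresses [b] through [a] and [c], and conjugation by [a] carries copies from one
    address to another; so the generated subgroup is closed under both zooms. *)
Lemma generated_x0_zoom (H : set F) : is_subgroup H -> H a -> H c -> forall f, H f.
Proof.
move=> sH Ha Hc; have [_ HM HV] := sH.
suff : generated [set a; c] = setT.
  move=> E f; have : [set: F] f by [].
  by rewrite -E; apply: generated_sub => // x [->|->].
pose K := generated [set a; c]; have sK : is_subgroup K by exact: generated_subgroup.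
have [_ KM KV] := sK.
have Ka : K a by apply: sub_generated; left.
have Kc : K c by apply: sub_generated; right.
have Kb : K b.
  have -> : b = a^-1 * (c^-1 * (a * a)) by rewrite pentagon -!mulgA !mulKg.
  by apply: (KM); [exact: KV|apply: (KM); [exact: KV|exact: KM]].
have Kcc : K (zoom true c).
  have -> : zoom true c = c ^ a^-1.
    have /= E := zoomwJ a (x0_maps1 [::]).
    by rewrite [X in _ = X ^ _]E -conjgM mulgV conjg1.
  by apply: (subgroupJ sK) => //; exact: KV.
have Kcb : K (zoom true b).
  have -> : b = a^-1 * (c^-1 * (a * a)) by rewrite pentagon -!mulgA !mulKg.
  rewrite !zoomM !zoomV.
  by apply: (KM); [exact: KV|apply: (KM); [exact: KV|exact: KM]].
apply/seteqP; split=> // f _; apply: (zoom_closed_full sK) => // d {}f.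
suff : K `<=` (fun k => K (zoom d k)) by apply.
apply: generated_sub; first exact: (subgroup_preim (@zoomM R d) sK).
move=> _ [->|->] /=; case: d => //.
have := zoomwJ a (x0_maps01 [::]); rewrite /= => ->.
exact: (subgroupJ sK).
Qed.

End Generators.

(** * Germs and compactly supported elements *)

Section Germs.
Variable R : realType.
Local Notation F := (thompsonF R).
Local Notation a := (x0 R).
Local Notation c1 := (zoom true (x0 R)).
Implicit Types (f g h k : F) (x y t c s : R).

(* [s = 1] is the germ on the right of [c], and [s = -1] the one on the left. *)
Definition slope s c (n : int) f := exists2 e : R, 0 < e &
  forall t, 0 <= s * (t - c) <= e -> ev f t = c + 2 ^ n * (t - c).

Definition fixnear s c f := exists2 e : R, 0 < e &
  forall t, 0 <= s * (t - c) <= e -> ev f t = t.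

Lemma slope0E s c f : slope s c 0 f <-> fixnear s c f.
Proof.
by split=> -[e e0 H]; exists e => // t /H; rewrite expr0z mul1r => ->;
  rewrite addrC subrK.
Qed.

Lemma slopeM s c m n f g : slope s c m f -> slope s c n g -> slope s c (m + n) (f * g)%g.
Proof.
move=> [e e0 H] [e' e0' H']; have n0 : (0 : R) < 2 ^ n by rewrite exprz_gt0.
exists (Num.min (e / 2 ^ n) e') => [|t /andP[t0]].
  by rewrite lt_min e0' divr_gt0.
rewrite le_min => /andP[te te'].
have gt : ev g t = c + 2 ^ n * (t - c) by apply: H'; rewrite t0.
rewrite evM gt H (addrAC c) subrr add0r; last first.
  by rewrite mulrCA mulr_ge0 ?(ltW n0)//= mulrC -ler_pdivlMr.
by rewrite mulrA expfzDr.
Qed.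

Lemma slopeV s c n f : slope s c n f -> slope s c (- n) f^-1%g.
Proof.
move=> [e e0 H]; have n0 : (0 : R) < 2 ^ n by rewrite exprz_gt0.
exists (2 ^ n * e) => [|t /andP[t0 te]]; first by rewrite mulr_gt0.
apply: (@ev_inj _ f); rewrite evVK H (addrAC c) subrr add0r.
  by rewrite mulrA -expfzDr// subrr expr0z mul1r addrC subrK.
rewrite mulrCA -invr_expz mulr_ge0 ?invr_ge0 ?(ltW n0)//=.
by rewrite mulrC ler_pdivrMr// (mulrC e).
Qed.

Lemma slope1 s c : slope s c 0 1%g.
Proof. by apply/slope0E; exists 1 => // t _; rewrite ev1. Qed.

Lemma slope_inj s c m n f : s != 0 -> slope s c m f -> slope s c n f -> m = n.
Proof.
move=> s0 [e e0 H] [e' e0' H']; pose d := Num.min e e' / s.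
have d0 : d != 0 by rewrite mulf_neq0 ?invr_neq0// lt0r_neq0// lt_min e0.
have dE : s * (c + d - c) = Num.min e e' by rewrite /d; field.
have := H (c + d); rewrite dE ge_min lexx le_min (ltW e0) (ltW e0') => /(_ isT) E.
have := H' (c + d); rewrite dE ge_min lexx orbT le_min (ltW e0) (ltW e0') => /(_ isT).
rewrite E (addrAC c) subrr add0r => /addrI /(mulIf d0).
by apply: ieexprIz => //; rewrite pnatr_eq1.
Qed.

Lemma seq_gap (l : seq R) c :
  exists2 e : R, 0 < e & forall d, d \in l -> d != c -> e <= `|d - c|.
Proof.
elim: l => [|x l [e e0 H]]; first by exists 1.
exists (if x == c then e else Num.min e `|x - c|).
  by case: eqP => // /eqP xc; rewrite lt_min e0 normr_gt0 subr_eq0.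
move=> d; rewrite inE => /predU1P[->|dl dc].
  by move=> /negbTE xc; rewrite xc ge_min lexx orbT.
by case: eqP => _; rewrite ?ge_min H.
Qed.

Lemma slope_ex s c f : (s == 1) || (s == -1) -> ev f c = c -> exists n, slope s c n f.
Proof.
move=> s1 fc; have [l _ lP] := ev_affine f; have [e e0 H] := seq_gap l c.
case/orP: s1 => /eqP->.
  have [||n nP] := lP c (c + e).
  - by rewrite lerDl ltW.
  - move=> d /H; case: (ltgtP d c) => [dc _|cd /(_ isT)|-> _]; [by left| |by left].
    by rewrite gtr0_norm ?subr_gt0// => ?; right; lra.
  exists n, e => // t; rewrite mul1r => t0; rewrite nP ?fc//.
  by move: t0; lra.
have [||n nP] := lP (c - e) c.
- by lra.
- move=> d /H; case: (ltgtP d c) => [dc /(_ isT)|cd _|-> _]; [|by right|by right].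
  by rewrite ltr0_norm ?subr_lt0// => ?; left; lra.
exists n, e => // t t0; rewrite nP; last by move: t0; lra.
have := nP c; rewrite fc lexx (_ : c - e <= c); last by lra.
by move=> /(_ isT) cE; rewrite [X in _ = X + _]cE; ring.
Qed.

Lemma fixnear_subgroup s c : is_subgroup (fixnear s c).
Proof.
split=> [|f g /slope0E hf /slope0E hg|f /slope0E hf]; apply/slope0E.
- exact: slope1.
- exact: (slopeM hf hg).
- exact: (slopeV hf).
Qed.

(** The slope exponent at a common fixed point is additive, so it vanishes on commutators. *)
Lemma fixnear_commg s c f g : (s == 1) || (s == -1) -> ev f c = c -> ev g c = c ->
  fixnear s c [~ f, g]%g.
Proof.
move=> s1 /(slope_ex s1)[m hf] /(slope_ex s1)[n hg]; apply/slope0E.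
have := slopeM (slopeV hf) (slopeM (slopeV hg) (slopeM hf hg)).
by rewrite (_ : - m + _ = 0); [|ring].
Qed.

(** Support in a compact subset of [(0, 1)], expressed by germs at the ends. This subgroup turns out
    to be the derived subgroup of F. *)
Definition compactly_supported : set F := fixnear 1 0 `&` fixnear (-1) 1.

Lemma compactly_supported_subgroup : is_subgroup compactly_supported.
Proof. by apply: subgroupI; exact: fixnear_subgroup. Qed.

Lemma compactly_supported_commg f g : compactly_supported [~ f, g]%g.
Proof.
split; apply: fixnear_commg; rewrite ?eqxx ?orbT//; by [rewrite ev_out0|rewrite ev_out1].
Qed.

Lemma compactly_supportedE f : compactly_supported f ->
  exists d, [/\ 0 < d, d < 1 / 2 & forall t, t <= d \/ 1 - d <= t -> ev f t = t].
Proof.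
move=> [[e e0 H] [e' e0' H']]; exists (Num.min (1 / 3) (Num.min e e')); split.
- by rewrite !lt_min e0 e0' andbT; lra.
- by rewrite gt_min; apply/orP; left; lra.
move=> t; rewrite !le_min [_ <= t]lerBlDr -lerBlDl !le_min.
case=> /and3P[t1 t2 t3].
  have [t0|t0] := leP t 0; first by rewrite ev_out0.
  by rewrite H// mul1r subr0 t2 (ltW t0).
have [t0|t0] := leP 1 t; first by rewrite ev_out1.
by rewrite H'//; lra.
Qed.

Lemma compactly_supportedI f d : 0 < d ->
  (forall t, t <= d \/ 1 - d <= t -> ev f t = t) -> compactly_supported f.
Proof.
by move=> d0 H; split; exists d => // t h; apply: H; [left|right]; lra.
Qed.

Lemma x0_gt t : 0 < t < 1 -> t < ev a t.
Proof.
move=> t01; rewrite x0E; have [_ P2 P3 P4 _] := x0_fun_pieces t.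
have [h|h] := leP t (1 / 4); first by rewrite P2; clear -h t01; lra.
have [h'|h'] := leP t (1 / 2); first by rewrite P3; clear -h h' t01; lra.
by rewrite P4; clear -h' t01; lra.
Qed.

Lemma zoom_gt b f t : (forall u, 0 < u < 1 -> u < ev f u) ->
  bit b 0 < t < bit b 1 -> t < ev (zoom b f) t.
Proof.
by move=> H; rewrite -(unbitK b t) zoomE !bit_lt; exact: H.
Qed.

Lemma bit_false0 : bit false 0 = 0 :> R. Proof. by rewrite /bit/=; field. Qed.
Lemma bit_false1 : bit false 1 = 1 / 2 :> R. Proof. by rewrite /bit/=; field. Qed.
Lemma bit_true0 : bit true 0 = 1 / 2 :> R. Proof. by rewrite /bit/=; field. Qed.
Lemma bit_true1 : bit true 1 = 1 :> R. Proof. by rewrite /bit/=; field. Qed.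

Lemma zoomw10_onto f : (forall t, t <= 1 / 2 \/ 3 / 4 <= t -> ev f t = t) ->
  exists g, f = zoomw [:: true; false] g.
Proof.
move=> H; have [t|g fg] := @zoom_onto _ true f.
  by rewrite bit_true0 bit_true1 => ?; apply: H; lra.
have [t|k gk] := @zoom_onto _ false g; last by exists k; rewrite fg gk.
rewrite bit_false0 bit_false1 => ht; apply: (can_inj (bitK true)).
by rewrite -zoomE -fg H// /bit/=; lra.
Qed.

(** Powers of [a] push [d] beyond 1/2; negative powers of [c1], which fix 1/2, then pull the image
    of [1 - d] below 3/4. *)
Lemma push_middle d : 0 < d < 1 / 2 ->
  exists h, 1 / 2 < ev h d /\ ev h (1 - d) < 3 / 4.
Proof.
move=> d0; have Ha t : d <= t <= 1 / 2 -> t < ev a t by move=> ht; apply: x0_gt; lra.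
have [n nP] := ev_escape Ha.
have h1 : ev (a ^+ n)%g (1 - d) < 1.
  by rewrite -[ltRHS](@ev_out1 _ (a ^+ n)%g) ?ev_lt//; lra.
have Hc t : 3 / 4 <= t <= ev (a ^+ n)%g (1 - d) -> t < ev c1 t.
  move=> ht; apply: zoom_gt x0_gt _; rewrite bit_true0 bit_true1; lra.
have [m mP] := ev_escape Hc.
exists ((c1 ^+ m)^-1 * a ^+ n)%g; rewrite !evM; split; last first.
  by rewrite -(ev_lt (c1 ^+ m)%g) evVK.
rewrite -(ev_lt (c1 ^+ m)%g) evVK; apply: le_lt_trans nP.
suff -> : ev (c1 ^+ m)%g (1 / 2) = 1 / 2 by [].
elim: m {mP} => [|m IH]; first by rewrite expg0 ev1.
by rewrite expgS evM IH zoom_fix// bit_true0; left.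
Qed.

Lemma compactly_supported_conj f : compactly_supported f ->
  exists k g, (f ^ k)%g = zoomw [:: true; false] g.
Proof.
move=> /compactly_supportedE[d [d0 d2 H]].
have [|h [h1 h2]] := @push_middle d; first by rewrite d0.
exists h^-1%g; apply: zoomw10_onto => t ht.
rewrite conjgE invgK !evM H ?evVK//.
by case: ht => ht; [left|right]; rewrite -(ev_le h) evVK ltW//; lra.
Qed.

(** The copy [y] of [a] on [[1/2, 3/4]] satisfies the pentagon, which exhibits a conjugate of [y] as
    a conjugate of an inverse commutator of compactly supported elements. By induction all copies on
    that interval lie in the next term of the series, and every compactly supported element is
    conjugate to such a copy. *)
Lemma compactly_supported_der n : compactly_supported `<=` der n.
Proof.
elim: n => // n IH.
pose z w := zoomw w a; pose v := [~ a, c1]%g.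
have sD : is_subgroup (der n.+1 : set F) by exact: der_subgroup.
have [_ DM DV] := sD.
(* The commutator [v], read from its rightmost factor, moves the address 101 through 110, 1110 and
   110 to 10. *)
have mv : maps_word v [:: true; false; true] [:: true; false].
  have h1 := maps_word_zoom true (@x0_maps01 R [::]).
  have h2 := @x0_maps1 R [:: true; false].
  have h3 := maps_word_zoom true (@x0_maps1 R [:: false]).
  have h4 := @x0_maps1 R [:: false].
  have := maps_word_comp (maps_word_comp (maps_word_comp h1 h2) (maps_word_inv h3))
    (maps_word_inv h4).
  by rewrite !mulgA.
have z101 : z [:: true; false; true] = (z [:: true; false] ^ v)%g by exact: zoomwJ.
have z100 : z [:: true; false; false] = (z [:: true; false] ^ c1)%g.
  by apply: zoomwJ; apply: maps_word_zoom; exact: x0_maps00.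
have penta : (z [:: true; false] * z [:: true; false] =
    z [:: true; false; true] * z [:: true; false] * z [:: true; false; false])%g.
  by rewrite -!zoomwM pentagon !zoomwM.
set y := z [:: true; false] in z101 z100 penta.
(* This solves [y * y = y ^ v * y * y ^ c1] for the last factor. *)
have yc : (y ^ c1 = [~ y, v]^-1 ^ y)%g.
  apply: (mulgI (y ^ v * y)%g); rewrite -z100 -{1}z101 -penta.
  by rewrite commgEl (conjgE _ y) (@invgM F) (@invgK F) !mulgA mulgK mulgV mul1g.
have yFc : compactly_supported y.
  apply: (@compactly_supportedI _ (1 / 4)); first by lra.
  move=> t ht; apply: zoomw_fix; rewrite /= /bit/=; lra.
have Dy : der n.+1 y.
  rewrite -(conjgK c1 y) yc; apply: derJ; apply: derJ; apply: DV.
  apply: der_commg; apply: IH => //; exact: compactly_supported_commg.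
have Dz g : der n.+1 (zoomw [:: true; false] g).
  apply: (generated_x0_zoom (H := fun k => der n.+1 (zoomw [:: true; false] k))) => //.
    exact: (subgroup_preim (zoomwM [:: true; false]) sD).
  by rewrite -[zoomw _ _]/(z [:: true; false; true]) z101; exact: derJ.
move=> f /compactly_supported_conj[k [g fk]].
by rewrite -(conjgK k f) fk; apply: derJ.
Qed.

End Germs.

(** * Displacing supports *)

Section Displacement.
Variable R : realType.
Local Notation F := (thompsonF R).
Local Notation a := (x0 R).
Local Notation c1 := (zoom true (x0 R)).
Implicit Types (f g h k z w : F) (x y t c e l r : R).

Lemma commg_fix f g t : ev f (ev g t) = ev g (ev f t) -> ev [~ f, g]%g t = t.
Proof. by move=> fg; rewrite !evM fg !evK. Qed.

Lemma conj_fix f k t : ev f (ev k t) = ev k t -> ev (f ^ k)%g t = t.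
Proof. by move=> fk; rewrite !evM fk evK. Qed.

Lemma expg_fix f n t : ev f t = t -> ev (f ^+ n)%g t = t.
Proof. by move=> ft; elim: n => [|n IH]; rewrite ?expg0 ?ev1// ev_expgS IH. Qed.

Definition fixon (D : R -> Prop) : set F := [set f | forall t, D t -> ev f t = t].

Lemma fixon_subgroup D : is_subgroup (fixon D).
Proof.
split=> [t _|f g hf hg t Dt|f hf t Dt]; first by rewrite ev1.
  by rewrite evM hg ?hf.
by apply: ev_fix; exact: hf.
Qed.

Definition moves_up f l r := forall t, l < t < r -> t < ev f t.

(* Conjugating [w] by a high power of [s] pushes its support into the region
   near [e] where [z] is trivial. *)
Lemma displace z w s c e : c < e -> ev s c = c -> ev s e = e -> moves_up s c e ->
  ev z c = c -> ev z e = e -> ev w e = e -> fixnear (-1) e z -> fixnear 1 c w ->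
  exists n, forall t, c <= t <= e -> ev [~ z, w ^ (s ^+ n)^-1]%g t = t.
Proof.
move=> ce sc se su zc ze we [d1 d10 hz] [d2 d20 hw].
(* [z] is trivial on [[m, e]] and [w] on [[c, u]]. Once a power of [s] takes [u] beyond [m], the
   conjugate of [w] is trivial on [[c, m]], and the supports inside [[c, e]] are disjoint. *)
pose m := Num.max (e - d1) ((c + e) / 2); pose u := Num.min (c + d2) ((c + e) / 2).
have me : m < e by rewrite gt_max; apply/andP; split; lra.
have cm : c < m by rewrite lt_max; apply/orP; right; lra.
have cu : c < u by rewrite lt_min; apply/andP; split; lra.
have ud : u <= c + d2 by rewrite ge_min lexx.
have dm : e - d1 <= m by rewrite le_max lexx.
have su' t : u <= t <= m -> t < ev s t.
  by move=> /andP[ut tm]; apply: su; rewrite (lt_le_trans cu ut) (le_lt_trans tm).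
have [n nP] := ev_escape su'; exists n => t /andP[ct te].
have hz' v : m <= v <= e -> ev z v = v.
  by move=> /andP[mv ve]; apply: hz; lra.
have hw' v : c <= v <= m -> ev (w ^ (s ^+ n)^-1)%g v = v.
  move=> /andP[cv vm]; apply: conj_fix; apply: hw; rewrite mul1r subr_ge0 lerBlDl.
  rewrite -(ev_le (s ^+ n)%g) evVK expg_fix// cv/=.
  apply: le_trans ud; rewrite -(ev_le (s ^+ n)%g) evVK.
  exact: le_trans vm (ltW nP).
have wsc : ev (w ^ (s ^+ n)^-1)%g c = c by apply: hw'; rewrite lexx ltW.
have wsm : ev (w ^ (s ^+ n)^-1)%g m = m by apply: hw'; rewrite lexx ltW.
have wse : ev (w ^ (s ^+ n)^-1)%g e = e.
  by apply: conj_fix; rewrite (ev_fix (expg_fix n se)).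
have zm : ev z m = m by apply: hz'; rewrite lexx ltW.
apply: commg_fix; have [tm|mt] := leP t m.
  rewrite (hw' t) ?ct// hw'//; apply/andP; split.
    by rewrite -[leLHS]zc ev_le.
  by rewrite -[leRHS]zm ev_le.
rewrite (hz' t); last by rewrite te ltW.
apply: hz'; apply/andP; split; last by rewrite -[leRHS]wse ev_le.
by rewrite -[leLHS]wsm ev_le ltW.
Qed.

(** Two passes: first every element of the generated group is shown to commute on [D] with [s1] and
    [s2], then with every other element. Invariance of [D] is carried along. *)
Lemma generated_commute (D : R -> Prop) (s1 s2 : F) :
  (forall t, D t <-> D (ev s1 t)) -> (forall t, D t <-> D (ev s2 t)) ->
  (forall t, D t -> ev s1 (ev s2 t) = ev s2 (ev s1 t)) ->
  forall z w, generated [set s1; s2] z -> generated [set s1; s2] w ->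
  forall t, D t -> ev [~ z, w]%g t = t.
Proof.
move=> D1 D2 D12.
pose K v : set F := fun z => (forall t, D t <-> D (ev z t)) /\
  forall t, D t -> ev z (ev v t) = ev v (ev z t).
have sK v : (forall t, D t <-> D (ev v t)) -> is_subgroup (K v).
  move=> Dv; split.
  - by split=> t; rewrite ?ev1.
  - move=> f g [Df fv] [Dg gv]; split=> t; rewrite !evM.
      by rewrite Dg; exact: Df.
    by move=> Dt; rewrite gv// fv//; apply: (Dg t).1.
  - move=> f [Df fv]; have DfV t : D t <-> D (ev f^-1%g t).
      by have := Df (ev f^-1%g t); rewrite evVK => -[? ?]; split.
    split=> // t Dt; apply: (@ev_inj _ f); rewrite evVK.
    by rewrite fv ?evVK//; apply: (DfV t).1.
have Ks v : (forall t, D t <-> D (ev v t)) -> K v s1 -> K v s2 ->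
    generated [set s1; s2] `<=` K v.
  by move=> Dv K1 K2; apply: generated_sub; [exact: sK|move=> _ [->|->]].
have G1 : generated [set s1; s2] `<=` K s1.
  by apply: Ks => //; split=> // t Dt; rewrite D12.
have G2 : generated [set s1; s2] `<=` K s2.
  by apply: Ks => //; split=> // t Dt; rewrite D12.
move=> z w Gz Gw t Dt; apply: commg_fix.
have [Dz zs1] := G1 z Gz; have [_ zs2] := G2 z Gz.
have [||_ wz] := Ks z Dz _ _ w Gw.
  by split=> // u Du; rewrite zs1.
by split=> // u Du; rewrite zs2.
by rewrite wz.
Qed.

(** * Realising compactly supported elements on an interval *)

Section Lift.
Variables (H : set F) (l r : R) (th : F -> F) (s1 s2 : F).
Hypothesis sH : is_subgroup H.
Hypothesis lr : 0 < l < r /\ r < 1.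
Hypothesis thM : {morph th : f g / (f * g)%g}.
Hypothesis thfix : forall f t, t <= l \/ r <= t -> ev (th f) t = t.
Hypothesis Hs1 : H s1.
Hypothesis Hs2 : H s2.
Hypothesis s1E : forall t, l <= t <= r -> ev s1 t = ev (th a) t.
Hypothesis s2E : forall t, l <= t <= r -> ev s2 t = ev (th c1) t.
(** Each side of [[l, r]] is treated in one of two ways: either [s1] and [s2] commute there, or some
    [s] in [H], trivial on [[l, r]], displaces supports on that side. *)
Let CR := forall t, r <= t -> ev s1 (ev s2 t) = ev s2 (ev s1 t).
Let CL := forall t, t <= l -> ev s1 (ev s2 t) = ev s2 (ev s1 t).
Hypothesis HR : CR \/ exists2 s, H s &
  (forall t, l <= t <= r -> ev s t = t) /\ moves_up s r 1.
Hypothesis HL : CL \/ exists2 s, H s &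
  (forall t, l <= t <= r -> ev s t = t) /\ moves_up s 0 l.

Let agree f z := forall t, l <= t <= r -> ev z t = ev (th f) t.
(** The elements whose copy on [[l, r]] is realised by an element of [Z], whatever the latter does
    outside. *)
Let lift (Z : set F) : set F := [set f | exists2 z, Z z & agree f z].

Let lP : l <= l <= r. Proof. by case: lr => /andP[_ /ltW h] _; rewrite lexx. Qed.
Let rP : l <= r <= r. Proof. by case: lr => /andP[_ /ltW h] _; rewrite lexx andbT. Qed.

Let th1 : th 1%g = 1%g.
Proof. by apply: (mulgI (th 1%g)); rewrite -thM !mulg1. Qed.

Let thV f : th f^-1%g = (th f)^-1%g.
Proof. by apply/eqP; rewrite -mulg_eq1 -thM mulVg th1. Qed.

Let th_range f t : l <= t <= r -> l <= ev (th f) t <= r.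
Proof.
move=> /andP[lt tr]; apply/andP; split.
  by rewrite -[leLHS](@thfix f) ?ev_le//; left.
by rewrite -[leRHS](@thfix f) ?ev_le//; right.
Qed.

Let agreel f z : agree f z -> ev z l = l.
Proof. by move=> fz; rewrite fz ?thfix//; left. Qed.

Let agreer f z : agree f z -> ev z r = r.
Proof. by move=> fz; rewrite fz ?thfix//; right. Qed.

Let agreeM f g z w : agree f z -> agree g w -> agree (f * g)%g (z * w)%g.
Proof. by move=> fz gw t tlr; rewrite thM !evM gw// fz// th_range. Qed.

Let agreeV f z : agree f z -> agree f^-1%g z^-1%g.
Proof.
move=> fz t tlr; apply: (@ev_inj _ z); rewrite evVK fz.
  by rewrite thV evVK.
by rewrite th_range.
Qed.

Let agreeR f g z w : agree f z -> agree g w -> agree [~ f, g]%g [~ z, w]%g.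
Proof. by move=> fz gw; do !(apply: agreeM => //); exact: agreeV. Qed.

Let lift_subgroup Z : is_subgroup Z -> is_subgroup (lift Z).
Proof.
move=> [Z1 ZM ZV]; split.
- by exists 1%g => // t _; rewrite th1.
- move=> f g [z Zz fz] [w Zw gw]; exists (z * w)%g; [exact: ZM|exact: agreeM].
- by move=> f [z Zz fz]; exists z^-1%g; [exact: ZV|exact: agreeV].
Qed.

(** Stages of the clean-up outside [[l, r]]: [Z1] has trivial germs at 0, at 1 and on the outer
    sides of [l] and [r], and is trivial on commuting sides; [Z2] is trivial right of [r], [Z3] on
    both sides. *)
Let Z0 := generated [set s1; s2].
Let D2 t := (CL /\ t <= l) \/ r <= t.
Let D1 t := (CL /\ t <= l) \/ (CR /\ r <= t).
Let Z2 := H `&` (fixnear 1 0 `&` (fixnear (-1) l `&` fixon D2)).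
Let Z1 := H `&` (fixnear 1 0 `&` (fixnear (-1) l `&`
  (fixnear 1 r `&` (fixnear (-1) 1 `&` fixon D1)))).
Let Z3 := H `&` fixon (fun t => t <= l \/ r <= t).

Let fixnear0 f g : fixnear 1 0 [~ f, g]%g.
Proof. by apply: fixnear_commg; rewrite ?eqxx// ev_out0. Qed.

Let lift0 f : lift Z0 f.
Proof.
apply: (generated_x0_zoom (H := lift Z0)).
- by apply: lift_subgroup; exact: generated_subgroup.
- by exists s1 => //; apply: sub_generated; left.
- by exists s2 => //; apply: sub_generated; right.
Qed.

Let Z0H : Z0 `<=` H.
Proof. by apply: generated_sub => // _ [->|->]. Qed.

(** Elements of [Z0] fix 0, [l], [r] and 1, so their commutators have trivial germs there; on a
    commuting side the commutators vanish altogether. *)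
Let lift1 f g : lift Z1 [~ f, g]%g.
Proof.
have [[z Zz fz] [w Zw gw]] := (lift0 f, lift0 g).
exists [~ z, w]%g; last exact: agreeR.
have sl : ev s1 l = l /\ ev s2 l = l by rewrite s1E// s2E// !thfix//; left.
have sr : ev s1 r = r /\ ev s2 r = r by rewrite s1E// s2E// !thfix//; right.
split; first by apply: (subgroupR sH); exact: Z0H.
split; first exact: fixnear0.
split; first by apply: fixnear_commg; rewrite ?eqxx ?orbT ?(agreel fz) ?(agreel gw).
split; first by apply: fixnear_commg; rewrite ?eqxx ?orbT ?(agreer fz) ?(agreer gw).
split; first by apply: fixnear_commg; rewrite ?eqxx ?orbT ?ev_out1.
move=> t [[cl tl]|[cr tr]].
  apply: (generated_commute (D := fun t => t <= l)) Zz Zw t tl => //= t.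
    by rewrite -{2}sl.1 ev_le.
  by rewrite -{2}sl.2 ev_le.
apply: (generated_commute (D := fun t => r <= t)) Zz Zw t tr => //= t.
  by rewrite -{2}sr.1 ev_le.
by rewrite -{2}sr.2 ev_le.
Qed.

Let conj_agree f z s n : (forall t, l <= t <= r -> ev s t = t) -> agree f z ->
  agree f (z ^ (s ^+ n)^-1)%g.
Proof.
move=> sE fz t tlr; have sn u : l <= u <= r -> ev (s ^+ n)%g u = u.
  by move=> ulr; apply: expg_fix; exact: sE.
rewrite conjgE invgK !evM (ev_fix (sn _ tlr)) fz// sn// th_range//.
Qed.

Let Z2_commg z w f g : H z -> H w -> agree f z -> agree g w -> fixon D2 [~ z, w]%g ->
  lift Z2 [~ f, g]%g.
Proof.
move=> Hz Hw fz gw h; exists [~ z, w]%g; last exact: agreeR.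
split; first exact: (subgroupR sH).
split; first exact: fixnear0.
by split=> //; apply: fixnear_commg; rewrite ?eqxx ?orbT ?(agreel fz) ?(agreel gw).
Qed.

(** Conjugating [w] by a power of [s] does not alter it on [[l, r]] and makes its commutator with
    [z] trivial right of [r]; triviality on a commuting left side survives. *)
Let lift2 f g : lift Z1 f -> lift Z1 g -> lift Z2 [~ f, g]%g.
Proof.
move=> [z [Hz [_ [_ [_ [z1 zD]]]]] fz] [w [Hw [_ [_ [wr [_ wD]]]]] gw].
have [l0 r1] := lr.
case: HR => [cr|[s Hs [sE su]]].
  apply: (Z2_commg Hz Hw fz gw) => t Dt; apply: commg_fix.
  have D1t : D1 t by case: Dt => ?; [left|right].
  by rewrite (wD t)// (zD t)// wD.
have [n nP] := displace r1 (sE r rP) (@ev_out1 _ s 1 (lexx _)) su (agreer fz)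
  (@ev_out1 _ z 1 (lexx _)) (@ev_out1 _ w 1 (lexx _)) z1 wr.
apply: (Z2_commg Hz _ fz (conj_agree n sE gw)).
  by apply: (subgroupJ sH) => //; have [_ _ HV] := sH; apply: HV; exact: subgroupX.
move=> t [[cl tl]|rt]; last first.
  have [t1|t1] := leP t 1; first by apply: nP; rewrite rt.
  by rewrite ev_out1// ltW.
have wt : ev (w ^ (s ^+ n)^-1)%g t = t.
  apply: conj_fix; apply: wD; left; split=> //.
  by rewrite -(ev_le (s ^+ n)%g) evVK (expg_fix n (sE l lP)).
by apply: commg_fix; rewrite wt (zD t) ?wt//; left.
Qed.

Let Z3_commg z w f g : H z -> H w -> agree f z -> agree g w ->
  fixon (fun t => t <= l \/ r <= t) [~ z, w]%g -> lift Z3 [~ f, g]%g.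
Proof.
move=> Hz Hw fz gw h; exists [~ z, w]%g; last exact: agreeR.
by split=> //; exact: (subgroupR sH).
Qed.

Let lift3 f g : lift Z2 f -> lift Z2 g -> lift Z3 [~ f, g]%g.
Proof.
move=> [z [Hz [_ [zl zD]]] fz] [w [Hw [w0 [_ wD]]] gw].
have [/andP[l0 ltr] r1] := lr.
case: HL => [cl|[s Hs [sE su]]].
  apply: (Z3_commg Hz Hw fz gw) => t Dt; apply: commg_fix.
  have D2t : D2 t by case: Dt => ?; [left|right].
  by rewrite (wD t)// (zD t)// wD.
have [n nP] := displace l0 (@ev_out0 _ s 0 (lexx _)) (sE l lP) su
  (@ev_out0 _ z 0 (lexx _)) (agreel fz) (agreel gw) zl w0.
apply: (Z3_commg Hz _ fz (conj_agree n sE gw)).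
  by apply: (subgroupJ sH) => //; have [_ _ HV] := sH; apply: HV; exact: subgroupX.
move=> t [tl|rt].
  have [t0|t0] := leP 0 t; first by apply: nP; rewrite t0.
  by rewrite ev_out0// ltW.
have wt : ev (w ^ (s ^+ n)^-1)%g t = t.
  apply: conj_fix; apply: wD; right.
  by rewrite -(ev_le (s ^+ n)%g) evVK (expg_fix n (sE r rP)).
by apply: commg_fix; rewrite wt (zD t) ?wt//; right.
Qed.

(** Three rounds of commutators clear the outside, and [f] survives them because it lies in the
    third derived subgroup. The realising element is then trivial off [[l, r]], hence equal to
    [th f]. *)
Lemma compactly_supported_lift f : compactly_supported f -> H (th f).
Proof.
have s1' : is_subgroup (lift Z1).
  by apply: lift_subgroup; do ![apply: subgroupI => //];
    [exact: fixnear_subgroup..|exact: fixon_subgroup].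
have s2' : is_subgroup (lift Z2).
  by apply: lift_subgroup; do ![apply: subgroupI => //];
    [exact: fixnear_subgroup..|exact: fixon_subgroup].
have s3' : is_subgroup (lift Z3).
  by apply: lift_subgroup; apply: subgroupI => //; exact: fixon_subgroup.
have d1 : der 1 `<=` lift Z1 by apply: (@der_sub _ 0 setT) => // x y _ _; exact: lift1.
have d2 := der_sub s2' d1 lift2; have d3 := der_sub s3' d2 lift3.
move=> /(@compactly_supported_der R 3)/d3[z [Hz zD] fz].
suff <- : z = th f by [].
apply: ev_ext => t; have [tl|lt] := leP t l; first by rewrite zD ?thfix//; left.
have [rt|tr] := leP r t; first by rewrite zD ?thfix//; right.
by rewrite fz// !ltW.
Qed.

End Lift.
End Displacement.

(** * Slopes *)

Section Model.
Local Open Scope group_scope.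
Variable R : realType.
Local Notation F := (thompsonF R).
Local Notation a := (x0 R).
Local Notation c1 := (zoom true (x0 R)).
Local Notation zoom10 := (@zoomw R [:: true; false]).
Implicit Types (f g h k : F) (t c e l r : R).

Lemma x0_half : ev a (1 / 2)%R = (3 / 4)%R.
Proof. by rewrite -bit_true0 x0_bit1 ?lexx ?ler01// /bit/=; field. Qed.

Lemma zoom10_fix f t : (t <= 1 / 2 \/ 3 / 4 <= t)%R -> ev (zoom10 f) t = t.
Proof. by move=> ht; apply: zoomw_fix; rewrite /= /bit/=; lra. Qed.

(** Induction on the exponent of the denominator: enlarging the half that contains [c] to the whole
    interval lowers it by one. *)
Lemma ev_transitive c : dyadic c -> (0 < c < 1)%R -> exists f, ev f c = (1 / 2)%R.
Proof.
move=> [m [k ->]] {c}; elim: k m => [|k IH] m.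
  by rewrite expr0 divr1 ltr0z -[1%R]/(1%:~R) ltr_int => /andP[m0]; rewrite ltNge -gtz0_ge1 m0.
set c := (m%:~R / _)%R => c01.
have k0 : (2 ^+ k != 0 :> R)%R by rewrite expf_neq0.
have cE : (m%:~R / 2 ^+ k = 2 * c :> R)%R by rewrite /c exprS; field.
have [c2|c2|->] := ltgtP c (1 / 2)%R; last by exists 1; rewrite ev1.
  have [|f fE] := IH m; first by rewrite cE; lra.
  (* The copy of [f] brings [c] to 1/4, which [a] takes to 1/2; in the other half the copy brings
     [c] to 3/4, which the inverse of [a] takes to 1/2. *)
  exists (a * zoom false f); rewrite evM -(unbitK false c) zoomE /unbit subr0 -cE fE.
  rewrite (_ : bit false (1 / 2)%R = bit false (bit true 0%R)); last by rewrite bit_true0.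
  by rewrite x0_bit01 ?lexx ?ler01// bit_false0 bit_true0.
have [|f fE] := IH (m - 2 ^+ k)%R.
  rewrite rmorphB rmorphXn/= mulrBl cE divff//; lra.
exists (a^-1 * zoom true f); rewrite evM -(unbitK true c) zoomE /unbit/=.
rewrite -cE (_ : (m%:~R / 2 ^+ k - 1)%R = ((m - 2 ^+ k)%:~R / 2 ^+ k)%R).
  rewrite fE (_ : bit true (1 / 2)%R = (3 / 4)%R); last by rewrite /bit/=; field.
  by rewrite -x0_half evK.
by rewrite rmorphB rmorphXn/= mulrBl divff.
Qed.

Lemma ev_transitive2 c e : dyadic c -> dyadic e -> (0 < c < e)%R -> (e < 1)%R ->
  exists f, ev f c = (1 / 2)%R /\ ev f e = (3 / 4)%R.
Proof.
move=> dc de /andP[c0 ce] e1.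
have [|f fc] := ev_transitive dc; first by rewrite c0 (lt_trans ce).
have fe2 : (1 / 2 < ev f e)%R by rewrite -fc ev_lt.
have fe1 : (ev f e < 1)%R by rewrite -[ltRHS](@ev_out1 _ f)// ev_lt.
have [||g gE] := @ev_transitive (unbit true (ev f e)).
- by apply/(dyadic_bit true); rewrite unbitK; exact: dyadic_ev.
- by rewrite /unbit/=; lra.
exists (zoom true g * f); rewrite !evM fc; split.
  by apply: zoom_fix; left; rewrite bit_true0.
by rewrite -(unbitK true (ev f e)) zoomE gE /bit/=; field.
Qed.

Definition zpow f (n : int) : F := match n with
  | Posz m => f ^+ m | Negz m => (f ^+ m.+1)^-1 end.

Lemma slope_zpow s c (m n : int) f : slope s c m f -> slope s c (m * n)%R (zpow f n).
Proof.
move=> hf; have H (k : nat) : slope s c (m * k%:Z)%R (f ^+ k).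
  elim: k => [|k IH]; first by rewrite mulr0 expg0; exact: slope1.
  by rewrite expgS intS mulrDr mulr1; exact: slopeM.
by case: n => n /=; [exact: H|rewrite NegzE mulrN; exact: slopeV].
Qed.

Lemma zpow_fix f n t : ev f t = t -> ev (zpow f n) t = t.
Proof. by move=> ft; case: n => n /=; [|apply: ev_fix]; exact: expg_fix. Qed.

Lemma slope_conj s c n f k : (s == 1)%R || (s == -1)%R -> ev k c = c ->
  slope s c n f -> slope s c n (f ^ k).
Proof.
move=> s1 /(slope_ex s1)[m hk] hf; have := slopeM (slopeV hk) (slopeM hf hk).
by have -> : (- m + (n + m) = n)%R by ring.
Qed.

Definition unidirectional f l r := moves_up f l r \/ moves_up f^-1 l r.

Lemma unidirectional_zpow f n l r : ev f l = l -> ev f r = r -> n != 0%R ->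
  unidirectional f l r -> unidirectional (zpow f n) l r.
Proof.
move=> fl fr n0 fu.
have up g m : ev g l = l -> ev g r = r -> moves_up g l r -> moves_up (g ^+ m.+1) l r.
  move=> gl gr gu; elim: m => [|m IH] t tlr; first by rewrite expg1; exact: gu.
  rewrite ev_expgS; have /andP[lt tr] := tlr.
  apply: lt_trans (IH _ tlr) _; apply: gu.
  by rewrite (lt_trans lt (IH _ tlr))/= -[ltRHS](expg_fix m.+1 gr) ev_lt.
have H m : unidirectional (f ^+ m.+1) l r.
  case: fu => fu; first by left; exact: up.
  by right; rewrite -expVgn; apply: up => //; exact: ev_fix.
case: n n0 => [[|n]//|n] _ /=; first exact: H.
by have [h|h] := H n; [right|left]; rewrite ?invgK.
Qed.

Lemma unidirectional_conj f k l r : unidirectional f (ev k l) (ev k r) ->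
  unidirectional (f ^ k) l r.
Proof.
have up g : moves_up g (ev k l) (ev k r) -> moves_up (g ^ k) l r.
  by move=> gu t tlr; rewrite !evM -(ev_lt k) evVK gu// !ev_lt.
by case=> h; [left|right; rewrite -conjVg]; exact: up.
Qed.

Lemma unidirectional_eq f g l r : ev g l = l -> ev g r = r ->
  (forall t, (l < t < r)%R -> ev f t = ev g t) ->
  unidirectional g l r -> unidirectional f l r.
Proof.
move=> gl gr fg [gu|gu]; [left|right] => t tlr; first by rewrite fg// gu.
have tlr' : (l < ev g^-1%g t < r)%R.
  case/andP: tlr => lt tr; apply/andP; split.
    by rewrite -[ltLHS](ev_fix gl) ev_lt.
  by rewrite -[ltRHS](ev_fix gr) ev_lt.
suff -> : ev f^-1 t = ev g^-1 t by exact: gu.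
by apply: (@ev_inj _ f); rewrite evVK fg// evVK.
Qed.

(** A conjugate depends only on the conjugating element at the points that it carries into the
    support. *)
Lemma conj_eq_on f h k l r : (forall t, (t <= l \/ r <= t)%R -> ev f t = t) ->
  (forall t, (l <= ev k t <= r)%R -> ev h t = ev k t) -> f ^ h = f ^ k.
Proof.
move=> ffix hk; apply: ev_ext => t.
have out u : ~~ (l <= u <= r)%R -> ev f u = u.
  by rewrite negb_and -!ltNge => /orP[/ltW|/ltW] h'; apply: ffix; [left|right].
have [/andP[lk kr]|kt] := boolP (l <= ev k t <= r)%R.
  rewrite !evM hk ?lk//; apply: (@ev_inj _ h); rewrite evVK hk ?evVK//.
  apply/andP; split.
    by rewrite -[leLHS](ffix l) ?ev_le//; left.
  by rewrite -[leRHS](ffix r) ?ev_le//; right.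
have [ht|ht] := boolP (l <= ev h t <= r)%R; last by rewrite !conj_fix ?out.
have := hk (ev k^-1 (ev h t)); rewrite evVK ht => /(_ isT)/ev_inj tE.
by move: kt; rewrite -{1 2}tE evVK ht.
Qed.

(** From left to right: a piece on [[0, 1/2]] with slope [2 ^ p] at 0, then four intervals of the
    orbit of 1/2 under [a] carrying the identity, a copy of [a], a copy of [c1] and the identity,
    then a piece with slope [2 ^ q] at 1. The last piece uses the inverse of [c1] because [c1] has
    slope 1/2 at 1. *)
Definition model (p q : int) : F := zpow (zoom false a) p * zoom10 a ^ (a ^+ 1)^-1 *
  zoom10 c1 ^ (a ^+ 2)^-1 * zpow c1^-1 q ^ (a ^+ 4)^-1.

Lemma slope_x0 : slope 1 0 1 a /\ slope (-1) 1 (-1) a.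
Proof.
split.
  exists (1 / 4)%R => [|t]; first by lra.
  rewrite mul1r subr0 add0r => ht; rewrite x0E.
  by have [_ -> //] := x0_fun_pieces t.
exists (1 / 2)%R => [|t ht]; first by lra.
rewrite x0E; have [_ _ _ P _] := x0_fun_pieces t.
by rewrite P -?[(2 ^ _)%R]/(2^-1)%R; clear P; lra.
Qed.

Lemma slope_zoom0 n f : slope 1 0 n f -> slope 1 0 n (zoom false f).
Proof.
move=> [e e0 H]; exists (e / 2)%R => [|t]; first by rewrite divr_gt0.
rewrite mul1r !subr0 => ht; rewrite -(unbitK false t) zoomE H /unbit /bit/=; last by lra.
by rewrite !subr0 !add0r !addr0; field.
Qed.

Lemma slope_zoom1 n f : slope (-1) 1 n f -> slope (-1) 1 n (zoom true f).
Proof.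
move=> [e e0 H]; exists (e / 2)%R => [|t ht]; first by rewrite divr_gt0.
rewrite -(unbitK true t) zoomE H /unbit /bit/=; last by lra.
by field.
Qed.

Lemma compactly_supported_slope f :
  compactly_supported f <-> slope 1 0 0 f /\ slope (-1) 1 0 f.
Proof. by split=> -[/slope0E ? /slope0E ?]. Qed.

Lemma zoom_false_slope1 f : slope (-1) 1 0 (zoom false f).
Proof.
apply/slope0E; exists (1 / 2)%R => [|t ht]; first by lra.
by apply: zoom_fix; right; rewrite bit_false1; lra.
Qed.

Lemma zoom_true_slope0 f : slope 1 0 0 (zoom true f).
Proof.
apply/slope0E; exists (1 / 2)%R => [|t ht]; first by lra.
by apply: zoom_fix; left; rewrite bit_true0; lra.
Qed.

Lemma slope_model p q : slope 1 0 p (model p q) /\ slope (-1) 1 q (model p q).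
Proof.
have [a0 a1] := slope_x0.
have cs f k : slope 1 0 0 (zoom10 f ^ k) /\ slope (-1) 1 0 (zoom10 f ^ k).
  have [] : slope 1 0 0 (zoom10 f) /\ slope (-1) 1 0 (zoom10 f).
    apply/compactly_supported_slope; apply: (@compactly_supportedI _ _ (1 / 4)%R).
      by lra.
    by move=> t ht; apply: zoom10_fix; lra.
  by split; apply: slope_conj; rewrite ?eqxx ?orbT//; [exact: ev_out0|exact: ev_out1].
split.
  have h1 := slope_zpow p (slope_zoom0 a0); rewrite mul1r in h1.
  have h2 := slope_zpow q (slopeV (zoom_true_slope0 a)); rewrite oppr0 mul0r in h2.
  have h3 : slope 1 0 0 (zpow c1^-1 q ^ (a ^+ 4)^-1).
    by apply: slope_conj h2; rewrite ?eqxx//; exact: ev_out0.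
  have := slopeM (slopeM (slopeM h1 (cs a (a ^+ 1)^-1).1) (cs c1 (a ^+ 2)^-1).1) h3.
  by rewrite !addr0.
have h1 := slope_zpow p (zoom_false_slope1 a); rewrite mul0r in h1.
have h2 := slope_zpow q (slopeV (slope_zoom1 a1)); rewrite opprK mul1r in h2.
have h3 : slope (-1) 1 q (zpow c1^-1 q ^ (a ^+ 4)^-1).
  by apply: slope_conj h2; rewrite ?eqxx ?orbT//; exact: ev_out1.
have := slopeM (slopeM (slopeM h1 (cs a (a ^+ 1)^-1).2) (cs c1 (a ^+ 2)^-1).2) h3.
by rewrite !add0r.
Qed.

End Model.

(** * The conjugating element *)

Section Core.
Local Open Scope group_scope.
Variable R : realType.
Local Notation F := (thompsonF R).
Local Notation a := (x0 R).
Local Notation c1 := (zoom true (x0 R)).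
Local Notation zoom10 := (@zoomw R [:: true; false]).
Implicit Types (f g h k x : F) (t c d e l r : R).

Lemma orbit_lt x c i : (c < ev x c)%R -> (ev (x ^+ i)%g c < ev (x ^+ i.+1)%g c)%R.
Proof. by move=> cx; rewrite expgSr evM ev_lt. Qed.

Lemma orbit_le x c i j : (c < ev x c)%R -> (i <= j)%N ->
  (ev (x ^+ i)%g c <= ev (x ^+ j)%g c)%R.
Proof.
move=> cx /subnK <-; elim: (j - i)%N => // m IH.
by rewrite addSn (le_trans IH)// ltW// orbit_lt.
Qed.

(* [h] carries the intervals [[x^i c, x^(i+1) c]] to [[a^i (1/2), a^(i+1) (1/2)]]
   so that [x] becomes [a] there. *)
Lemma conjugator x h1 c : dyadic c -> (c < ev x c)%R -> ev h1 c = (1 / 2)%R ->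
  ev h1 (ev x c) = (3 / 4)%R -> forall n, exists h,
  [/\ forall t, (t <= c)%R -> ev h t = ev h1 t,
      forall i t, (i <= n)%N -> (ev (x ^+ i)%g c <= t <= ev (x ^+ i.+1)%g c)%R ->
        ev h t = ev (a ^+ i * h1 * (x ^+ i)^-1)%g t &
      forall t, (ev (x ^+ n)%g c <= t)%R -> ev h t = ev (a ^+ n * h1 * (x ^+ n)^-1)%g t].
Proof.
move=> dc cx h1c h1x; elim=> [|n [h [hl hi hr]]].
  exists h1; split=> // [i t|t _].
    by rewrite leqn0 => /eqP-> _; rewrite !expg0 mul1g invg1 mulg1.
  by rewrite !expg0 mul1g invg1 mulg1.
have [||g [gl gr]] := @thompson_glue _ h (a ^+ n.+1 * h1 * (x ^+ n.+1)^-1) (ev (x ^+ n.+1)%g c).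
- exact: dyadic_ev.
- rewrite hr ?ltW ?orbit_lt// !evM evK h1c expgSr evM evK h1x.
  by rewrite expgSr evM x0_half.
exists g; split=> // [t tc|i t].
  rewrite gl ?hl//; apply: (le_trans tc).
  by have := orbit_le cx (leq0n n.+1); rewrite expg0 ev1.
rewrite leq_eqVlt => /predU1P[->|]; first by case/andP=> h' _; exact: gr.
rewrite ltnS => ni /andP[it ti]; rewrite gl; first by rewrite (hi i)// it.
by rewrite (le_trans ti)// orbit_le.
Qed.

(** On the points that reach the factor shifted by [a ^+ i], the element [h] is
    [a ^+ i * h1 * (x ^+ i)^-1], so the powers of [a] built into [model] turn into powers of [x]. *)
Lemma model_conj p q x h1 c : dyadic c -> (c < ev x c)%R -> ev h1 c = (1 / 2)%R ->
  ev h1 (ev x c) = (3 / 4)%R ->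
  exists h, model R p q ^ h = zpow (zoom false a) p ^ h1 *
    (zoom10 a ^ h1) ^ (x ^+ 1)^-1 * (zoom10 c1 ^ h1) ^ (x ^+ 2)^-1 *
    (zpow c1^-1 q ^ h1) ^ (x ^+ 4)^-1.
Proof.
move=> dc cx h1c h1x; have [h [hl hi hr]] := conjugator dc cx h1c h1x 4.
have step i lo hi' f : (forall t, (t <= lo \/ hi' <= t)%R -> ev f t = t) ->
    (forall t, (lo <= ev h1 (ev (x ^+ i)^-1%g t) <= hi')%R ->
      ev h t = ev (a ^+ i * h1 * (x ^+ i)^-1)%g t) ->
    (f ^ (a ^+ i)^-1) ^ h = (f ^ h1) ^ (x ^+ i)^-1.
  move=> ffix hE; rewrite (@conj_eq_on _ _ h (a ^+ i * h1 * (x ^+ i)^-1)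
    (ev (a ^+ i)%g lo) (ev (a ^+ i)%g hi')).
  - by rewrite -!conjgM !mulgA mulVg mul1g.
  - move=> t ht; apply: conj_fix; apply: ffix.
    by case: ht => ht; [left|right]; rewrite -(ev_le (a ^+ i)) evVK.
  - by move=> t; rewrite !evM !ev_le => /hE; rewrite !evM.
have mid i f : (i <= 4)%N ->
    (zoom10 f ^ (a ^+ i)^-1) ^ h = (zoom10 f ^ h1) ^ (x ^+ i)^-1.
  move=> i4; apply: (@step i (1 / 2)%R (3 / 4)%R); first exact: zoom10_fix.
  move=> t; rewrite -h1c -h1x !ev_le => ht; apply: hi => //; move: ht.
  by rewrite -(ev_le (x ^+ i)) -[X in _ && X](ev_le (x ^+ i)) evVK expgSr evM.
have E1 : zpow (zoom false a) p ^ h = zpow (zoom false a) p ^ h1.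
  apply: (@conj_eq_on _ _ _ _ 0 (1 / 2)%R) => t.
    case=> ht; first by rewrite ev_out0.
    by apply: zpow_fix; apply: zoom_fix; right; rewrite bit_false1.
  by rewrite -h1c ev_le => /andP[_ /hl].
have E4 : (zpow c1^-1 q ^ (a ^+ 4)^-1) ^ h = (zpow c1^-1 q ^ h1) ^ (x ^+ 4)^-1.
  apply: (@step 4 (1 / 2)%R 1%R) => t.
    case=> ht; last by rewrite ev_out1.
    by apply: zpow_fix; apply: ev_fix; apply: zoom_fix; left; rewrite bit_true0.
  rewrite -h1c ev_le => /andP[ht _]; apply: hr.
  by rewrite -(ev_le (x ^+ 4)^-1) evK.
exists h; rewrite -E1 -E4 -(mid 1%N a isT) -(mid 2%N c1 isT).
by rewrite /model 3!(conjMg _ _ h).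
Qed.

Lemma zoom10_onto_compact f d : (0 < d)%R ->
  (forall t, (t <= 1 / 2 + d \/ 3 / 4 - d <= t)%R -> ev f t = t) ->
  exists2 g, compactly_supported g & f = zoom10 g.
Proof.
move=> d0 H; have [t ht|g fg] := @zoomw10_onto _ f; first by apply: H; lra.
exists g => //; apply: (@compactly_supportedI _ _ (4 * d)%R); first by lra.
move=> t ht; have inj : injective (@word R [:: true; false]).
  move=> u v uv; case: (ltgtP u v) => //;
    by rewrite -(word_lt [:: true; false]) uv ltxx.
by apply: inj; rewrite -zoomwE -fg H// /= /bit/=; lra.
Qed.

(* Conjugation by an element of [H] squeezes any compact support into [(l, r)]. *)
Lemma compactly_supported_spread (H : set F) h1 l r kL kR : is_subgroup H ->
  H kL -> H kR -> (0 < l)%R -> (r < 1)%R ->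
  ev h1 l = (1 / 2)%R -> ev h1 r = (3 / 4)%R ->
  (forall f, compactly_supported f -> H (zoom10 f ^ h1)) ->
  (forall t, (0 < t <= l)%R -> (t < ev kL t)%R) ->
  (forall t, (r <= t < 1)%R -> (t < ev kR t)%R) ->
  ev kR l = l \/ ev kL r = r ->
  @compactly_supported R `<=` H.
Proof.
move=> sH HL HR l0 r1 hl hr Hz upL upR LR f.
move=> /compactly_supportedE[d [d0 d2 fd]].
suff [u [Hu u1 u2]] : exists u, [/\ H u, (l < ev u d)%R & (ev u (1 - d) < r)%R].
  have [||g gc fg] := @zoom10_onto_compact (f ^ (h1 * u)^-1)
    (Num.min (ev h1 (ev u d) - 1 / 2) (3 / 4 - ev h1 (ev u (1 - d))))%R.
  - by rewrite lt_min !subr_gt0 -hl -hr !ev_lt u1.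
  - move=> t ht; apply: conj_fix; apply: fd.
    have -> : (ev (h1 * u)^-1%g t <= d)%R = (t <= ev h1 (ev u d))%R.
      by rewrite -[LHS](ev_le (h1 * u)) evVK evM.
    have -> : (1 - d <= ev (h1 * u)^-1%g t)%R = (ev h1 (ev u (1 - d)) <= t)%R.
      by rewrite -[LHS](ev_le (h1 * u)) evVK evM.
    move: ht; set e := Num.min _ _ => ht.
    have e1 : (e <= ev h1 (ev u d) - 1 / 2)%R by rewrite ge_min lexx.
    have e2 : (e <= 3 / 4 - ev h1 (ev u (1 - d)))%R by rewrite ge_min lexx orbT.
    by case: ht => ht; [left|right]; lra.
  have -> : f = (zoom10 g ^ h1) ^ u by rewrite -fg -!conjgM mulVg conjg1.
  by apply: (subgroupJ sH) => //; exact: Hz.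
(* The order of the two moves depends on the fixed end. If [kR] fixes [l], first [kL] lifts [d]
   above [l], then [kR] backwards lowers [1 - d] below [r]; if [kL] fixes [r], the lowering comes
   first. *)
have [_ HM HV] := sH; case: LR => fixk.
  have [t /andP[dt tl]|n nP] := @ev_escape _ kL d l.
    by apply: upL; rewrite (lt_le_trans d0 dt).
  have b1 : (ev (kL ^+ n)%g (1 - d) < 1)%R.
    by rewrite -[ltRHS](@ev_out1 _ (kL ^+ n))// ev_lt; lra.
  have [t /andP[rt tb]|m mP] := @ev_escape _ kR r (ev (kL ^+ n)%g (1 - d)%R).
    by apply: upR; rewrite rt (le_lt_trans tb).
  exists ((kR ^+ m)^-1 * kL ^+ n); split.
  - by apply: (HM); [apply: HV|]; exact: subgroupX.
  - by rewrite evM -(ev_lt (kR ^+ m)) evVK expg_fix.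
  - by rewrite evM -(ev_lt (kR ^+ m)) evVK.
have [t /andP[rt td]|n nP] := @ev_escape _ kR r (1 - d)%R.
  by apply: upR; rewrite rt (le_lt_trans td)//; lra.
have b0 : (0 < ev (kR ^+ n)^-1%g d)%R.
  by rewrite -[ltLHS](@ev_out0 _ (kR ^+ n)^-1)// ev_lt.
have [t /andP[dt tl]|m mP] := @ev_escape _ kL (ev (kR ^+ n)^-1%g d) l.
  by apply: upL; rewrite (lt_le_trans b0 dt).
exists (kL ^+ m * (kR ^+ n)^-1); split.
- by apply: (HM); [|apply: HV]; exact: subgroupX.
- by rewrite evM.
- rewrite evM -[ltRHS](expg_fix m fixk) ev_lt.
  by rewrite -(ev_lt (kR ^+ n)) evVK.
Qed.

End Core.

(** * Generating all compactly supported elements from [x] and a conjugate of the model *)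

Section CoreTheorem.
Local Open Scope group_scope.
Variable R : realType.
Local Notation F := (thompsonF R).
Local Notation a := (x0 R).
Local Notation c1 := (zoom true (x0 R)).
Local Notation zoom10 := (@zoomw R [:: true; false]).
Implicit Types (f g h k x : F) (t c d e l r : R).

Lemma unidirectional_subgroup (H : set F) f l r : is_subgroup H -> H f ->
  unidirectional f l r -> exists2 s, H s &
    moves_up s l r /\ forall t, ev f t = t -> ev s t = t.
Proof.
move=> [_ _ HV] Hf [up|up]; first by exists f.
by exists f^-1; [exact: HV|split=> // t; exact: ev_fix].
Qed.

Lemma ev_conj f k t : ev (f ^ k) t = ev k^-1 (ev f (ev k t)).
Proof. by rewrite conjgE !evM. Qed.

Lemma ev_conjV f k t : ev (f ^ k^-1) (ev k t) = ev k (ev f t).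
Proof. by rewrite conjgE invgK !evM evK. Qed.

(** On each side of [c], either the outer piece of [model] displaces points or [x] itself moves them
    up. This provides what is needed to fill [[c, e]], where [e] is the image of [c] under [x], and
    to squeeze all supports into it. *)
Lemma model_cogenerates p q x c : dyadic c -> (0 < c)%R -> (c < ev x c)%R ->
  (p != 0 \/ forall t, (0 < t <= c)%R -> (t < ev x t)%R)%R ->
  (q != 0 \/ forall t, (c <= t < 1)%R -> (t < ev x t)%R)%R ->
  (p != 0 \/ q != 0)%R ->
  exists h, forall H : set F, is_subgroup H -> H x -> H (model R p q ^ h) ->
    @compactly_supported R `<=` H.
Proof.
move=> dc c0 cx hp hq hpq.
have c_1 : (c < 1)%R by rewrite ltNge; apply/negP => h; move: cx; rewrite ev_out1 ?ltxx.
pose e := ev x c; have ce : (c < e)%R := cx.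
have e_1 : (e < 1)%R by rewrite -[ltRHS](@ev_out1 _ x)// ev_lt.
have [|h1 [h1c h1e]] := ev_transitive2 dc (dyadic_ev x dc) _ e_1.
  by rewrite c0.
have [h gE] := model_conj p q dc cx h1c h1e.
exists h => H sH Hx; rewrite gE; have [_ HM HV] := sH.
set P := zpow _ p ^ h1; set A := zoom10 a ^ h1; set B := zoom10 c1 ^ h1.
set Q := zpow _ q ^ h1; set g := _ * _ => Hg.
have Pfix t : (c <= t)%R -> ev P t = t.
  move=> ct; apply: conj_fix; apply: zpow_fix; apply: zoom_fix; right.
  by rewrite bit_false1 -h1c ev_le.
have Qfix t : (t <= c)%R -> ev Q t = t.
  move=> ct; apply: conj_fix; apply: zpow_fix; apply: ev_fix; apply: zoom_fix.
  by left; rewrite bit_true0 -h1c ev_le.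
have thfix f t : (t <= c)%R \/ (e <= t)%R -> ev (zoom10 f ^ h1)%g t = t.
  move=> ht; apply: conj_fix; apply: zoom10_fix; rewrite -h1c -h1e !ev_le.
  by case: ht; [left|right].
pose o i := ev (x ^+ i)%g c.
have o0 : o 0%N = c by rewrite /o expg0 ev1.
have oS i : o i.+1 = ev (x ^+ i)%g e by rewrite /o expgSr evM.
have o1 : o 1%N = e by rewrite oS expg0 ev1.
have ole i j : (i <= j)%N -> (o i <= o j)%R by exact: orbit_le.
have olo i f t : (forall u, (u <= c)%R -> ev f u = u) -> (t <= o i)%R ->
    ev (f ^ (x ^+ i)^-1)%g t = t.
  by move=> ff ti; apply: conj_fix; apply: ff; rewrite -(ev_le (x ^+ i)) evVK.
have ohi i f t : (forall u, (e <= u)%R -> ev f u = u) -> (o i.+1 <= t)%R ->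
    ev (f ^ (x ^+ i)^-1)%g t = t.
  by move=> ff ti; apply: conj_fix; apply: ff; rewrite -(ev_le (x ^+ i)) evVK -oS.
have Alo t : (t <= o 1%N)%R -> ev (A ^ (x ^+ 1)^-1)%g t = t.
  by apply: olo => u uc; apply: thfix; left.
have Ahi t : (o 2%N <= t)%R -> ev (A ^ (x ^+ 1)^-1)%g t = t.
  by apply: ohi => u uc; apply: thfix; right.
have Blo t : (t <= o 2%N)%R -> ev (B ^ (x ^+ 2)^-1)%g t = t.
  by apply: olo => u uc; apply: thfix; left.
have Bhi t : (o 3%N <= t)%R -> ev (B ^ (x ^+ 2)^-1)%g t = t.
  by apply: ohi => u uc; apply: thfix; right.
have Qlo t : (t <= o 4%N)%R -> ev (Q ^ (x ^+ 4)^-1)%g t = t by exact: olo.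
have gev t : ev g t = ev P (ev (A ^ (x ^+ 1)^-1)%g (ev (B ^ (x ^+ 2)^-1)%g
    (ev (Q ^ (x ^+ 4)^-1)%g t))) by rewrite /g !evM.
have [le01 [le12 [le23 le34]]] : (o 0%N <= o 1%N)%R /\ (o 1%N <= o 2%N)%R /\
    (o 2%N <= o 3%N)%R /\ (o 3%N <= o 4%N)%R by do ![split]; exact: ole.
have g0 t : (t <= o 0%N)%R -> ev g t = ev P t.
  by move=> t0; rewrite gev Qlo ?Blo ?Alo//; lra.
have g1 t : (o 0%N <= t <= o 1%N)%R -> ev g t = t.
  move=> /andP[t0 t1]; rewrite gev Qlo ?Blo ?Alo ?Pfix//; try lra.
have g2 t : (o 1%N <= t <= o 2%N)%R -> ev g t = ev (A ^ (x ^+ 1)^-1)%g t.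
  move=> /andP[t1 t2]; rewrite gev Qlo ?Blo//; try lra.
  apply: Pfix; rewrite -o0 (le_trans le01)// -[leLHS](Alo (o 1%N))//.
  by rewrite ev_le.
have g3 t : (o 2%N <= t <= o 3%N)%R -> ev g t = ev (B ^ (x ^+ 2)^-1)%g t.
  move=> /andP[t2 t3]; rewrite gev Qlo//; last by lra.
  have h2 : (o 2%N <= ev (B ^ (x ^+ 2)^-1)%g t)%R.
    by rewrite -[leLHS](Blo (o 2%N))// ev_le.
  by rewrite Ahi// Pfix// -o0; lra.
have g4 t : (o 3%N <= t <= o 4%N)%R -> ev g t = t.
  move=> /andP[t3 t4]; rewrite gev Qlo// Bhi// Ahi ?Pfix//; last by lra.
  by rewrite -o0; lra.
have g5 t : (o 4%N <= t)%R -> ev g t = ev (Q ^ (x ^+ 4)^-1)%g t.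
  move=> t4; rewrite gev.
  have h4 : (o 4%N <= ev (Q ^ (x ^+ 4)^-1)%g t)%R.
    by rewrite -[leLHS](Qlo (o 4%N))// ev_le.
  by rewrite Bhi ?Ahi ?Pfix//; rewrite -?o0; lra.
(* Conjugation by [x ^+ i] brings the piece of [g] on [[o i, o i.+1]] back to [[c, e]]: the
   identity, [A], [B] and the identity for [i] from 0 to 3. *)
pose s i := g ^ (x ^+ i).
have Hs i : H (s i) by apply: (subgroupJ sH) => //; exact: subgroupX.
have sE i t : ev (s i)%g t = ev (x ^+ i)^-1%g (ev g (ev (x ^+ i)%g t)) by rewrite !evM.
have xlo i t : (c <= t)%R -> (o i <= ev (x ^+ i)%g t)%R by rewrite /o ev_le.
have xhi i t : (t <= e)%R -> (ev (x ^+ i)%g t <= o i.+1)%R by rewrite oS ev_le.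
have s0E t : (c <= t <= e)%R -> ev (s 0%N)%g t = t.
  by move=> /andP[h2 h3]; rewrite sE g1 ?evK// xlo//= xhi.
have s1E t : (c <= t <= e)%R -> ev (s 1%N)%g t = ev A t.
  by move=> /andP[h2 h3]; rewrite sE g2 ?xlo//= ?xhi// ev_conjV evK.
have s2E t : (c <= t <= e)%R -> ev (s 2%N)%g t = ev B t.
  by move=> /andP[h2 h3]; rewrite sE g3 ?xlo//= ?xhi// ev_conjV evK.
have s3E t : (c <= t <= e)%R -> ev (s 3%N)%g t = t.
  by move=> /andP[h2 h3]; rewrite sE g4 ?evK// xlo//= xhi.
have s3r t : (e <= t)%R -> ev (s 3%N)%g t = ev (Q ^ x^-1)%g t.
  move=> et; rewrite sE g5 ?oS ?ev_le//.
  have -> : Q ^ (x ^+ 4)^-1 = (Q ^ x^-1) ^ (x ^+ 3)^-1.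
    by rewrite (expgSr x 3) (@invgM F) conjgM.
  by rewrite ev_conjV evK.
have s4E t : (c <= t)%R -> ev (s 4%N)%g t = ev Q t.
  by move=> ct; rewrite sE g5 ?xlo// ev_conjV evK.
have kE t : (t <= e)%R -> ev (g ^ x^-1)%g t = ev (P ^ x^-1)%g t.
  move=> te; have t0 : (ev x^-1%g t <= o 0%N)%R by rewrite o0 -(ev_le x) evVK.
  by rewrite (ev_conj g) (ev_conj P) g0.
have Pc : ev P c = c by exact: Pfix.
have Qc : ev Q c = c by exact: Qfix.
have xVe : ev x^-1%g e = c by rewrite /e evK.
have uP : p != 0%R -> unidirectional P 0 c.
  move=> p0; apply: unidirectional_conj; rewrite ev_out0// h1c.
  apply: unidirectional_zpow => //; first by rewrite ev_out0.
    by apply: zoom_fix; right; rewrite bit_false1.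
  left=> t ht; apply: zoom_gt; first by move=> u; exact: x0_gt.
  by rewrite bit_false0 bit_false1.
have uQ : q != 0%R -> unidirectional Q c 1.
  move=> q0; apply: unidirectional_conj; rewrite (@ev_out1 _ h1 1%R)// h1c.
  apply: unidirectional_zpow => //; last 1 first.
  - right=> t ht; rewrite invgK; apply: zoom_gt; first by move=> u; exact: x0_gt.
    by rewrite bit_true0 bit_true1.
  - by apply: ev_fix; apply: zoom_fix; left; rewrite bit_true0.
  - by rewrite ev_out1.
(* [s 4] acts as [Q] right of [c] and so, unlike [s 3], also moves [e]; if [q = 0], [x] takes its
   place. *)
have [kR [HkR kRu kRc]] : exists k, [/\ H k,
    forall t, (e <= t < 1)%R -> (t < ev k t)%R & q != 0%R -> ev k c = c].
  case: (eqVneq q 0%R) hq => [q0|q0 _].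
    case=> [//|hx]; exists x; split=> // t /andP[et t1]; apply: hx.
    by rewrite t1 (le_trans (ltW ce)).
  have [|k Hk [ku kfix]] := @unidirectional_subgroup H (s 4%N) c 1 sH (Hs _).
    apply: (unidirectional_eq Qc _ _ (uQ q0)); first by rewrite ev_out1.
    by move=> t /andP[ct _]; apply: s4E; exact: ltW.
  exists k; split=> // [t /andP[et t1]|_]; last by apply: kfix; rewrite s4E.
  by apply: ku; rewrite (lt_le_trans ce).
(* Conjugating [g] by the inverse of [x] stretches the action of [P] from [(0, c)] to [(0, e)], so
   that [c] moves too; if [p = 0], [x] takes its place. *)
have [kL [HkL kLu kLe]] : exists k, [/\ H k,
    forall t, (0 < t <= c)%R -> (t < ev k t)%R & p != 0%R -> ev k e = e].
  case: (eqVneq p 0%R) hp => [p0|p0 _].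
    by case=> [//|hx]; exists x; split.
  have HgV : H (g ^ x^-1) by apply: (subgroupJ sH) => //; exact: HV.
  have PVe : ev (P ^ x^-1)%g e = e by apply: conj_fix; rewrite xVe.
  have [|k Hk [ku kfix]] := @unidirectional_subgroup H _ 0 e sH HgV.
    apply: (unidirectional_eq _ PVe); first by rewrite ev_out0.
      by move=> t /andP[_ te]; apply: kE; exact: ltW.
    by apply: unidirectional_conj; rewrite ev_out0// xVe; exact: uP.
  exists k; split=> // [t /andP[t0 tc]|_]; last by apply: kfix; rewrite kE.
  by apply: ku; rewrite t0 (le_lt_trans tc).
apply: (@compactly_supported_spread _ H h1 c e kL kR) => //; last first.
  by case: hpq => ?; [right; exact: kLe|left; exact: kRc].
pose th f := zoom10 f ^ h1.
have thM : {morph th : u v / u * v} by move=> u v; rewrite /th zoomwM conjMg.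
have lr : (0 < c < e)%R /\ (e < 1)%R by rewrite c0.
apply: (@compactly_supported_lift _ H c e th (s 1%N) (s 2%N) sH lr thM thfix
  (Hs _) (Hs _) s1E s2E).
(* If [q = 0], nothing of [g] remains beyond [o 3], so [s 2] is trivial right of [e] and commutes
   with [s 1] there; otherwise [s 3] or its inverse displaces that side. *)
- case: (eqVneq q 0%R) => [q0|q0]; [left|right].
    have Q1 : Q = 1 by rewrite /Q q0 /= expg0 conj1g.
    have s2id t : (e <= t)%R -> ev (s 2%N)%g t = t.
      move=> et; rewrite sE; have o3t : (o 3%N <= ev (x ^+ 2)%g t)%R by rewrite oS ev_le.
      have [h4|h4] := leP (ev (x ^+ 2)%g t) (o 4%N); first by rewrite g4 ?o3t// evK.
      by rewrite g5 ?ltW// Q1 conj1g ev1 evK.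
    have s1e : ev (s 1%N) e = e.
      by rewrite s1E ?(ltW ce) ?lexx//; apply: thfix; right.
    by move=> t et; rewrite (s2id t)// s2id// -[leLHS]s1e ev_le.
  have [|k Hk [ku kfix]] := @unidirectional_subgroup H (s 3%N) e 1 sH (Hs _).
    apply: (@unidirectional_eq _ _ (Q ^ x^-1)).
    + by apply: conj_fix; rewrite xVe.
    + by rewrite ev_out1.
    + by move=> t /andP[et _]; apply: s3r; exact: ltW.
    by apply: unidirectional_conj; rewrite xVe (@ev_out1 _ x^-1)//; exact: uQ.
  by exists k => //; split=> // t /s3E/kfix.
(* If [p = 0], [s 1] is trivial left of [c]; otherwise [s 0] or its inverse displaces that side. *)
case: (eqVneq p 0%R) => [p0|p0]; [left|right].
  have P1 : P = 1 by rewrite /P p0 /= expg0 conj1g.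
  have s1id t : (t <= c)%R -> ev (s 1%N)%g t = t.
    move=> tc; rewrite sE; have t1 : (ev (x ^+ 1)%g t <= o 1%N)%R by rewrite ev_le.
    have [h4|h4] := leP (ev (x ^+ 1)%g t) (o 0%N); first by rewrite g0// P1 ev1 evK.
    by rewrite g1 ?(ltW h4)// evK.
  have s2c : ev (s 2%N) c = c.
    by rewrite s2E ?(ltW ce) ?lexx//; apply: thfix; left.
  by move=> t tc; rewrite (s1id t)// s1id// -[leRHS]s2c ev_le.
have [|k Hk [ku kfix]] := @unidirectional_subgroup H (s 0%N) 0 c sH (Hs _).
  apply: (@unidirectional_eq _ _ P) => //; first by rewrite ev_out0.
    by move=> t /andP[_ tc]; rewrite sE expg0 invg1 !ev1 g0// o0 ltW.
  exact: uP.
by exists k => //; split=> // t /s0E/kfix.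
Qed.

End CoreTheorem.

(** * Abelianization *)

Section AbelianizedCogeneration.
Local Open Scope group_scope.
Variable G : groupType.
Implicit Types (x y z : G) (K H : set G).

(** Subgroups of the abelianization correspond to subgroups of [G] that contain the derived
    subgroup, so later arguments can stay inside [G]. *)
Lemma cogenerator_abP x y :
  cogenerator (to_abelianization x) (to_abelianization y) <->
  forall K, is_subgroup K -> @derived_subgroup G `<=` K -> K x -> K y ->
    forall z, K z.
Proof.
split=> [xy K sK dK Kx Ky z|xy].
  have [K1 KM KV] := sK.
  pose L : set (abelianization G) :=
    fun u => exists2 w, K w & to_abelianization w = u.
  have sL : is_subgroup L.
    split; first by exists 1.
      move=> _ _ [u Ku <-] [v Kv <-]; exists (u * v); first exact: KM.
      exact: to_abM.
    by move=> _ [u Ku <-]; exists u^-1; [exact: KV|exact: to_abV].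
  have : L (to_abelianization z).
    have : generated [set to_abelianization x; to_abelianization y]
      (to_abelianization z) by rewrite xy.
    by apply: generated_sub => // _ [->|->]; [exists x|exists y].
  case=> w Kw /to_abelianizationP/dK Kwz.
  by rewrite -(mulVKg w z); exact: KM.
apply/seteqP; split=> // u _; rewrite -(to_abelianizationK u).
set L := generated _; have sL : is_subgroup L by exact: generated_subgroup.
apply: (xy (fun z => L (to_abelianization z))).
- by apply: (subgroup_preim _ sL); exact: to_abM.
- move=> z dz; have -> : to_abelianization z = to_abelianization 1.
    by apply/esym/to_abelianizationP; rewrite invg1 mul1g.
  by have [] := sL.
- by apply: sub_generated; left.
- by apply: sub_generated; right.
Qed.

End AbelianizedCogeneration.

(** * Slopes as the abelianization, and the two bounds *)

Section UniformSemiSpreadOfF.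
Local Open Scope group_scope.
Variable R : realType.
Local Notation F := (thompsonF R).
Local Notation a := (x0 R).
Local Notation c1 := (zoom true (x0 R)).
Local Notation b1 := (zoom false (x0 R)).
Implicit Types (f g h x : F) (t c : R) (K : set F).

Lemma derived_compactly_supported : @derived_subgroup F `<=` @compactly_supported R.
Proof.
apply: generated_sub; first exact: compactly_supported_subgroup.
by move=> _ [f [g ->]]; exact: compactly_supported_commg.
Qed.

Lemma compactly_supported_derived : @compactly_supported R `<=` @derived_subgroup F.
Proof. by move=> f /(@compactly_supported_der R 1)/(@der1_derived F). Qed.

Lemma slopes_ex f : exists i j, slope 1 0 i f /\ slope (-1) 1 j f.
Proof.
have [||i hi] := @slope_ex R 1 0 f; rewrite ?eqxx ?ev_out0//.
have [||j hj] := @slope_ex R (-1) 1 f; rewrite ?eqxx ?orbT ?ev_out1//.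
by exists i, j.
Qed.

Lemma derived_slopes f : derived_subgroup f -> slope 1 0 0 f /\ slope (-1) 1 0 f.
Proof. by move=> /derived_compactly_supported/compactly_supported_slope. Qed.

Lemma slopes_b1 : slope 1 0 1 b1 /\ slope (-1) 1 0 b1.
Proof.
by have [? _] := slope_x0 R; split; [exact: slope_zoom0|exact: zoom_false_slope1].
Qed.

Lemma slopes_c1 : slope 1 0 0 c1 /\ slope (-1) 1 (-1) c1.
Proof.
by have [_ ?] := slope_x0 R; split; [exact: zoom_true_slope0|exact: slope_zoom1].
Qed.

(* The linear forms on Z^2 detect that the slopes of a generating pair of the
   abelianization are linearly independent. *)
Lemma cogenerator_slopes x g (i j p q m n : int) :
  cogenerator (to_abelianization x) (to_abelianization g) ->
  slope 1 0 i x -> slope (-1) 1 j x -> slope 1 0 p g -> slope (-1) 1 q g ->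
  (i * m + j * n = 0 -> p * m + q * n = 0 -> m = 0 /\ n = 0)%R.
Proof.
move=> /cogenerator_abP cog x0' x1 g0 g1 hx hg.
pose K : set F := fun f => exists u v,
  [/\ slope 1 0 u f, slope (-1) 1 v f & (u * m + v * n = 0)%R].
have sK : is_subgroup K.
  split.
  - by exists 0%R, 0%R; split; rewrite ?mul0r ?addr0//; exact: slope1.
  - move=> f h [u [v [? ? uv]]] [u' [v' [? ? uv']]].
    exists (u + u')%R, (v + v')%R; split; try exact: slopeM.
    by rewrite !mulrDl addrACA uv uv' addr0.
  - move=> f [u [v [? ? uv]]]; exists (- u)%R, (- v)%R; split; try exact: slopeV.
    by rewrite !mulNr -opprD uv oppr0.
have all f : K f.
  apply: cog => // [h /derived_slopes[? ?]||].
  - by exists 0%R, 0%R; split; rewrite ?mul0r ?addr0.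
  - by exists i, j.
  - by exists p, q.
have n1 : ((1 : R) != 0)%R by rewrite oner_eq0.
have n2 : ((-1 : R) != 0)%R by rewrite oppr_eq0 oner_eq0.
have [[u [v [bu bv uv]]] [u' [v' [cu cv uv']]]] := (all b1, all c1).
have [b0 b1'] := slopes_b1; have [c0 c1'] := slopes_c1.
move: uv uv'; rewrite (slope_inj n1 bu b0) (slope_inj n2 bv b1').
rewrite (slope_inj n1 cu c0) (slope_inj n2 cv c1') mul1r !mul0r addr0 add0r.
by move=> -> /eqP; rewrite mulN1r oppr_eq0 => /eqP.
Qed.

Lemma small_dyadic (e : R) : (0 < e)%R -> exists2 d : R, dyadic d & (0 < d < e)%R.
Proof.
move=> e0; pose k := Num.bound e^-1; exists (1 / 2 ^+ k)%R; first by exists 1%R, k.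
have k0 : (0 < 2 ^+ k :> R)%R by rewrite exprn_gt0.
rewrite divr_gt0//= div1r -(invrK e) ltf_pV2 ?posrE ?invr_gt0//.
exact: upper_nthrootP.
Qed.

Lemma moves_up_near0 f i : slope 1 0 i f -> i != 0%R -> exists2 c, dyadic c &
  (0 < c)%R /\ ((forall t, (0 < t <= c)%R -> (t < ev f t)%R) \/
               (forall t, (0 < t <= c)%R -> (t < ev f^-1%g t)%R)).
Proof.
have up g j : slope 1 0 j g -> (0 < j)%R -> exists2 c, dyadic c &
    (0 < c)%R /\ forall t, (0 < t <= c)%R -> (t < ev g t)%R.
  move=> [e e0 H] j0; have [d dd /andP[d0 de]] := small_dyadic e0.
  exists d => //; split=> // t /andP[t0 td].
  rewrite H ?mul1r ?subr0 ?add0r; last by rewrite (ltW t0) (le_trans td)// ltW.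
  by rewrite ltr_pMl// -[ltLHS](expr0z 2) ltr_eXz2l// ltr1n.
move=> hf; rewrite neq_lt => /orP[i0|i0].
  have [|c dc [c0 cu]] := up f^-1 (- i)%R (slopeV hf); first by rewrite oppr_gt0.
  by exists c => //; split=> //; right.
by have [c dc [c0 cu]] := up f i hf i0; exists c => //; split=> //; left.
Qed.

(** At the right end the sign is reversed: a negative exponent flattens the graph near 1 and lifts
    it above the diagonal. *)
Lemma moves_up_near1 f i : slope (-1) 1 i f -> i != 0%R -> exists2 c, dyadic c &
  (0 < c < 1)%R /\ ((forall t, (c <= t < 1)%R -> (t < ev f t)%R) \/
               (forall t, (c <= t < 1)%R -> (t < ev f^-1%g t)%R)).
Proof.
have up g j : slope (-1) 1 j g -> (j < 0)%R -> exists2 c, dyadic c &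
    (0 < c < 1)%R /\ forall t, (c <= t < 1)%R -> (t < ev g t)%R.
  move=> [e e0 H] j0.
  have [|d dd /andP[d0 de]] := @small_dyadic (Num.min e 1%R); first by rewrite lt_min e0 ltr01.
  move: de; rewrite lt_min => /andP[de d1].
  exists (1 - d)%R; first by apply: dyadicD (dyadicN dd); exact: (dyadic_nat R 1).
  split=> [|t /andP[ct t1]]; first by lra.
  rewrite H; last by lra.
  have j1 : (2 ^ j < 1 :> R)%R.
    by rewrite -[ltRHS](expr0z 2) ltr_eXz2l// ltr1n.
  have : (0 < (1 - 2 ^ j) * (1 - t))%R by rewrite mulr_gt0 ?subr_gt0.
  by lra.
move=> hf; rewrite neq_lt => /orP[i0|i0].
  by have [c dc [c0 cu]] := up f i hf i0; exists c => //; split=> //; left.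
have [|c dc [c0 cu]] := up f^-1 (- i)%R (slopeV hf); first by rewrite oppr_lt0.
by exists c => //; split=> //; right.
Qed.

Lemma model_conj_cogenerator p q x :
  cogenerator (to_abelianization x) (to_abelianization (model R p q)) ->
  exists h, cogenerator x (model R p q ^ h).
Proof.
move=> cog; set g := model R p q.
have [g0 g1] := slope_model R p q; have [i [j [hi hj]]] := slopes_ex x.
have indep := cogenerator_slopes cog hi hj g0 g1.
(* A subgroup with all compactly supported elements contains the derived subgroup, hence also [g],
   which differs from [g ^ h] by a commutator; cogeneration in the abelianization then yields
   everything. *)
suff [h hP] : exists h, forall H : set F, is_subgroup H -> H x -> H (g ^ h) ->
    @compactly_supported R `<=` H.
  exists h; apply/seteqP; split=> // f _.
  set H := generated _; have sH : is_subgroup H by exact: generated_subgroup.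
  have Hx : H x by apply: sub_generated; left.
  have Hgh : H (g ^ h) by apply: sub_generated; right.
  have cH := hP H sH Hx Hgh; have [_ HM HV] := sH.
  apply: ((cogenerator_abP _ _).1 cog H sH) => //.
    by move=> z /derived_compactly_supported/cH.
  rewrite -[model R p q]/g -(mulgK [~ g, h] g); apply: (HM); last first.
    by apply: HV; apply: cH; exact: compactly_supported_commg.
  by rewrite commgEl mulVKg.
have pq0 : (p != 0 \/ q != 0)%R.
  have [p0|?] := eqVneq p 0%R; last by left.
  have [q0|?] := eqVneq q 0%R; last by right.
  (* If [p = q = 0], the form with coefficients [j] and [- i] kills both slope vectors, so
     [i = j = 0]; then every form kills them, a contradiction. *)
  have [||j0 i0] := indep j (- i)%R; rewrite ?p0 ?q0 ?mul0r ?addr0//.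
    by rewrite mulrN mulrC subrr.
  have i0' : i = 0%R by apply/eqP; rewrite -oppr_eq0 i0.
  by have [||/eqP] := indep 1%R 0%R; rewrite ?p0 ?q0 ?i0' ?mul0r ?mulr0 ?addr0.
have ij0 : (i != 0 \/ j != 0)%R.
  have [i0|?] := eqVneq i 0%R; last by left.
  have [j0|?] := eqVneq j 0%R; last by right.
  have [||q0 p0] := indep q (- p)%R; rewrite ?i0 ?j0 ?mul0r ?addr0//.
    by rewrite mulrN mulrC subrr.
  by case: pq0 => /eqP[]//; apply/eqP; rewrite -oppr_eq0 p0.
(* Independence makes [i * q - j * p] nonzero, so [x] has slope other than 1 at one end and [g] at
   the opposite end. There [x] or its inverse moves points up, and both generate the same
   subgroup. *)
have [p0i|[p0 j0]] : (q != 0 /\ i != 0 \/ p != 0 /\ j != 0)%R.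
  have [p0|p0] := eqVneq p 0%R.
    left; case: pq0 => [|q0]; first by rewrite p0 eqxx.
    split=> //; apply/negP => /eqP i0.
    by have [||/eqP] := indep 1%R 0%R; rewrite ?p0 ?i0 ?mul0r ?mulr0 ?addr0.
  have [q0|q0] := eqVneq q 0%R; last by case: ij0; [left|right].
  right; split=> //; apply/negP => /eqP j0.
  by have [||_ /eqP] := indep 0%R 1%R; rewrite ?q0 ?j0 ?mul0r ?mulr0 ?addr0.
- have [q0 i0] := p0i.
  have [c dc [c0 [up|up]]] := moves_up_near0 hi i0.
    apply: (model_cogenerates dc c0);
      [by apply: up; rewrite c0 /=|by right|by left|by right].
  have [||||h hP] := @model_cogenerates R p q x^-1 c dc c0.
  + by apply: up; rewrite c0/=.
  + by right.
  + by left.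
  + by right.
  by exists h => H sH Hx; apply: hP => //; have [_ _ HV] := sH; exact: HV.
have [c dc [/andP[c0 c_1] [up|up]]] := moves_up_near1 hj j0.
  apply: (model_cogenerates dc c0);
    [by apply: up; rewrite lexx|by left|by right|by left].
have [||||h hP] := @model_cogenerates R p q x^-1 c dc c0.
+ by apply: up; rewrite lexx.
+ by left.
+ by right.
+ by left.
by exists h => H sH Hx; apply: hP => //; have [_ _ HV] := sH; exact: HV.
Qed.

(** [model] with the end slopes of a representative of [u] differs from it by a compactly supported
    element, hence has class [u]. *)
Lemma uniform_semi_spread_ge1 : uniform_semi_spread_ge F 1.
Proof.
move=> u _; have [p [q [hp hq]]] := slopes_ex (repr u).
have [g0 g1] := slope_model R p q.
have gu : to_abelianization (model R p q) = u.
  rewrite -[RHS]to_abelianizationK; apply/to_abelianizationP.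
  apply: compactly_supported_derived; apply/compactly_supported_slope.
  have := slopeM (slopeV g1) hq; have := slopeM (slopeV g0) hp.
  by rewrite !addNr.
exists (model R p q); split=> // x cog.
have [h hP] := model_conj_cogenerator (cog ord0).
by exists h => i; rewrite (ord1 i).
Qed.

(** [g] moves points up near 0 and down near 1; by monotonicity the supremum of the points moved up
    is fixed. *)
Lemma fixpoint_between g : slope 1 0 1 g -> slope (-1) 1 1 g ->
  exists2 t, (0 < t < 1)%R & ev g t = t.
Proof.
move=> [e e0 H0] [d d0 H1].
pose A : set R := [set t | (t < ev g t)%R].
pose t0 := Num.min e (1 / 2)%R; have t00 : (0 < t0)%R by rewrite lt_min e0; lra.
have te : (t0 <= e)%R by rewrite ge_min lexx.
have At0 : A t0.
  rewrite /A /= H0 ?mul1r ?subr0 ?add0r ?expr1z; first by lra.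
  by rewrite ltW.
pose m := Num.max 0 (1 - d)%R.
have m1 : (m < 1)%R by rewrite gt_max ltr01; lra.
have dm : (1 - d <= m)%R by rewrite le_max lexx orbT.
have Am : ubound A m.
  move=> t At; rewrite leNgt; apply/negP => mt; move: At; rewrite /A /=.
  have [t1|t1] := leP 1%R t; first by rewrite ev_out1// ltxx.
  by rewrite H1 ?expr1z; [lra|lra].
have sA : has_sup A by split; [exists t0|exists m].
have ts : (t0 <= sup A)%R by apply: ub_le_sup At0; exists m.
have sm : (sup A <= m)%R by apply: ge_sup => //; exists t0.
exists (sup A); first by lra.
have [gs|gs|//] := ltgtP (ev g (sup A)) (sup A).
  have [t At gt'] := sup_gt sA.1 gs; have : (t <= sup A)%R by apply: ub_le_sup At; exists m.
  by rewrite -(ev_le g) leNgt (lt_trans gt' At).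
have : A (ev g (sup A)) by rewrite /A /= ev_lt.
by move/(ub_le_sup (ex_intro _ m Am)); rewrite leNgt gs.
Qed.

(** Modulo commutators the pentagon reads [a = c1 * b1]. *)
Lemma b1_c1_full K : is_subgroup K -> @derived_subgroup F `<=` K -> K b1 -> K c1 ->
  forall f, K f.
Proof.
move=> sK dK Kb Kc; have [_ KM KV] := sK; apply: generated_x0_zoom => //.
have -> : a = c1 * [~ c1, a] * b1.
  by apply: (mulgI a); rewrite pentagon commgEl mulVKg conjgE !mulgA mulgV mul1g.
by apply: (KM) => //; apply: (KM) => //; apply: dK; exact: derived_commg.
Qed.

(** The class of [b1 * c1^-1] has slope 2 at both ends, so every conjugate of a member fixes an
    interior point [s]. Since [c1] fixes the left half and [b1] the right half, one of them fixes
    [s] as well, and so does the subgroup it generates with the conjugate; but [a] moves [s]. *)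
Lemma uniform_semi_spread_lt2 k : (1 < k)%N -> ~ uniform_semi_spread_ge F k.
Proof.
move=> k1 /(_ (to_abelianization (b1 * c1^-1))).
have cog y g : y = b1 \/ y = c1 ->
    to_abelianization g = to_abelianization (b1 * c1^-1) ->
    cogenerator (to_abelianization y) (to_abelianization g).
  move=> yE /to_abelianizationP gE; apply/cogenerator_abP => K sK dK Ky Kg.
  have [_ KM KV] := sK.
  have Kbc : K (b1 * c1^-1) by rewrite -(mulVKg g (_ * _)); apply: KM => //; exact: dK.
  case: yE Ky => -> Ky; apply: b1_c1_full => //.
    have -> : c1 = (b1 * c1^-1)^-1 * b1 by rewrite (@invgM F) (@invgK F) mulgVK.
    by apply: KM => //; exact: KV.
  by rewrite -(mulgVK c1 b1); apply: KM.
case.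
  exists (to_abelianization b1); have : cogenerator (to_abelianization b1)
    (to_abelianization (b1 * c1^-1)) by apply: cog => //; left.
  by rewrite /cogenerator setUC.
move=> g [gE gP].
pose x (i : 'I_k) : F := if i == 0%N :> nat then b1 else c1.
have [i|h hP] := gP x.
  by apply: cog => //; rewrite /x; case: ifP => _; [left|right].
have [b0 b1'] := slopes_b1; have [c0 c1'] := slopes_c1.
have dg : derived_subgroup ((b1 * c1^-1)^-1 * g) by apply/to_abelianizationP.
have [d0 d1] := derived_slopes dg.
have s0 := slopeM (slopeM b0 (slopeV c0)) d0; have s1 := slopeM (slopeM b1' (slopeV c1')) d1.
rewrite mulVKg oppr0 !addr0 in s0; rewrite mulVKg opprK add0r addr0 in s1.
have [t t01 gt'] := fixpoint_between s0 s1.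
pose s := ev h^-1%g t.
have s01 : (0 < s < 1)%R.
  by rewrite -[ltLHS](@ev_out0 _ h^-1 0%R)// -[X in _ && X](ev_lt h) evVK (@ev_out1 _ h 1%R)// ev_lt.
have gs : ev (g ^ h)%g s = s by apply: conj_fix; rewrite evVK.
have nofix y : cogenerator y (g ^ h) -> ev y s <> s.
  move=> yg ys; have : fixon (fun v => v = s) a.
    have : generated [set y; g ^ h] a by rewrite yg.
    apply: generated_sub; first exact: fixon_subgroup.
    by move=> _ [->|->] _ ->.
  by move=> /(_ s erefl) as_; have := x0_gt s01; rewrite as_ ltxx.
have k0 : (0 < k)%N by exact: ltnW.
have [s2|s2] := leP s (1 / 2)%R.
  apply: (nofix (x (Ordinal k1))); first exact: hP.
  by rewrite /x /=; apply: zoom_fix; left; rewrite bit_true0.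
apply: (nofix (x (Ordinal k0))); first exact: hP.
by rewrite /x /=; apply: zoom_fix; right; rewrite bit_false1 ltW.
Qed.


End UniformSemiSpreadOfF.

Theorem mainTheorem3 (R : realType) :
  uniform_semi_spread R (thompsonF R) = 1%:E.
Proof.
apply/eqP; rewrite eq_le; apply/andP; split.
  apply: ge_ereal_sup => _ [k hk <-]; rewrite lee_fin -[leRHS]/(1%:R) ler_nat leqNgt.
  by apply/negP => /(@uniform_semi_spread_lt2 R).
apply: ereal_sup_ubound; exists 1%N => //; exact: uniform_semi_spread_ge1.
Qed.
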